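(* Let $A$ be an Artinian local ring, let $B$ be a finitely generated standard $\mathbb{N}^r$-graded $A$-algebra, and let $M$ be a finitely generated $\mathbb{Z}^r$-graded $B$-module. Let $d=\dim(M)$. Then for each $\mathbf n\in\mathbb{N}^r$ with $|\mathbf n|=d$ there exists a Laurent polynomial $Q_{\mathbf n}(\mathbf t)\in\mathbb{Z}[t_1,\ldots,t_r,t_1^{-1},\ldots,t_r^{-1}]$ with $Q_{\mathbf n}(\mathbf 1)\ge0$, such that $$\mathrm{Hilb}_M(\mathbf t)=\sum_{\mathbf n\in\mathbb{N}^r,\ |\mathbf n|=d}\frac{Q_{\mathbf n}(\mathbf t)}{(1-t_1)^{n_1}\cdots(1-t_r)^{n_r}},$$ and the following statements hold: (i) There is at least one $\mathbf n\in\mathbb{N}^r$ with $|\mathbf n|=d$ such that $Q_{\mathbf n}(\mathbf 1)>0$. (ii) If $Q_{\mathbf n}(\mathbf t)\ne0$ and $Q_{\mathbf n}(\mathbf 1)=0$, then $Q_{\mathbf n}(\mathbf t)$ is divisible by $(1-t_i)$ for some $1\le i\le r$ such that $n_i\ne0$.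
   Context: $\mathbb{N}=\{0,1,2,\ldots\}$, $r\ge1$. Standard means that $[B]_{\mathbf 0}=A$ and $B$ is generated over $A$ by finitely many elements of degrees $\mathbf e_1,\ldots,\mathbf e_r$ (the standard basis vectors of $\mathbb{Z}^r$). $|\mathbf n|=n_1+\cdots+n_r$, $\mathbf 0=(0,\ldots,0)$, $\mathbf 1=(1,\ldots,1)$, $\mathbf t=(t_1,\ldots,t_r)$; $\dim$ is Krull dimension. The Hilbert series is $\mathrm{Hilb}_M(\mathbf t)=\sum_{\nu\in\mathbb{Z}^r}\mathrm{length}_A([M]_\nu)\,t_1^{\nu_1}\cdots t_r^{\nu_r}$, where $[M]_\nu$ is the graded part of $M$ of degree $\nu$; denominators $(1-t_i)$ are expanded as geometric series in $t_i$. *)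

(* Defs.v *)
From HB Require Import structures.
From mathcomp Require Import all_boot all_order all_algebra finmap monalg.
From mathcomp Require Import boolp classical_sets fsbigop.

Set Implicit Arguments.
Unset Strict Implicit.
Unset Printing Implicit Defensive.

Import GRing.Theory Num.Theory.
Local Open Scope classical_set_scope.
Local Open Scope ring_scope.

Notation nvec r := {ffun 'I_r -> nat}.
Notation zvec r := {ffun 'I_r -> int}.

Definition absdeg (r : nat) (n : nvec r) : nat := (\sum_(i < r) n i)%N.
Definition nunit (r : nat) (i : 'I_r) : nvec r := [ffun j => nat_of_bool (j == i)].
Definition zvec_of (r : nat) (n : nvec r) : zvec r := [ffun i => (n i)%:Z].

Definition has_chain (T : Type) (P : set (set T)) (l : nat) : Prop :=
  exists C : nat -> set T,
    (forall i, (i <= l)%N -> P (C i)) /\ (forall i, (i < l)%N -> C i `<` C i.+1).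

(* The supremum of the lengths of strict chains in P is the natural number l.
   This fails for every l when P is empty or has arbitrarily long chains. *)
Definition sup_chain_length (T : Type) (P : set (set T)) (l : nat) : Prop :=
  has_chain P l /\ forall l', has_chain P l' -> (l' <= l)%N.

Definition is_ideal (R : comNzRingType) (I : set R) : Prop :=
  [/\ I 0, (forall x y, I x -> I y -> I (x + y))
    & (forall a x, I x -> I (a * x))].

Definition is_prime_ideal (R : comNzRingType) (p : set R) : Prop :=
  [/\ is_ideal p, ~ p 1 & forall x y, p (x * y) -> p x \/ p y].

Definition is_maximal_ideal (R : comNzRingType) (m : set R) : Prop :=
  [/\ is_ideal m, ~ m 1
    & forall I, is_ideal I -> m `<=` I -> ~ I 1 -> I = m].

Definition local_ring (R : comNzRingType) : Prop :=
  exists! m : set R, is_maximal_ideal m.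

Definition artinian_ring (R : comNzRingType) : Prop :=
  forall I : nat -> set R,
    (forall k, is_ideal (I k)) -> (forall k, I k.+1 `<=` I k) ->
    exists k0, forall k, (k0 <= k)%N -> I k = I k0.

Definition annihilator (R : comNzRingType) (M : lmodType R) : set R :=
  [set b | forall m : M, b *: m = 0].

(* dim M is the Krull dimension of R / Ann M, whose primes are the primes of R
   containing Ann M. The zero module has no such prime, so no d qualifies. *)
Definition krull_dim (R : comNzRingType) (M : lmodType R) (d : nat) : Prop :=
  sup_chain_length [set p | is_prime_ideal p /\ annihilator M `<=` p] d.

Definition fin_gen_module (R : comNzRingType) (M : lmodType R) : Prop :=
  exists (k : nat) (g : 'I_k -> M),
    forall m : M, exists c : 'I_k -> R, m = \sum_(j < k) c j *: g j.

Section Length.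
Variables (A : comNzRingType) (B : comAlgType A) (M : lmodType B).

(* A acts on the B-module M through the structure map a |-> a%:A. *)
Definition is_Asubmodule (N : set M) : Prop :=
  [/\ N 0, (forall x y, N x -> N y -> N (x + y))
    & (forall (a : A) x, N x -> N (a%:A *: x))].

Definition length_A (N : set M) (l : nat) : Prop :=
  sup_chain_length [set N' | is_Asubmodule N' /\ N' `<=` N] l.

End Length.

Section Gradings.

(* V is the internal direct sum of its subgroups G n. *)
Definition direct_sum (D : eqType) (V : zmodType) (G : D -> set V) : Prop :=
  [/\ forall n, G n 0 /\ (forall x y, G n x -> G n y -> G n (x - y)),
      forall v, exists (s : seq D) (c : D -> V),
        [/\ uniq s, forall n, G n (c n) & v = \sum_(n <- s) c n]
    & forall (s : seq D) (c : D -> V), uniq s -> (forall n, G n (c n)) ->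
        \sum_(n <- s) c n = 0 -> forall n, n \in s -> c n = 0].

Variables (r : nat) (A : comNzRingType) (B : comAlgType A).
Implicit Type gB : nvec r -> set B.

Definition graded_algebra gB : Prop :=
  [/\ direct_sum gB,
      forall n (a : A) x, gB n x -> gB n (a *: x),
      gB 0 1
    & forall m n x y, gB m x -> gB n y -> gB (m + n) (x * y)].

Definition is_subalgebra (S : set B) : Prop :=
  [/\ forall a : A, S a%:A,
      forall x y, S x -> S y -> S (x + y)
    & forall x y, S x -> S y -> S (x * y)].

(* The first two conjuncts express [B]_0 = A: the structure map a |-> a%:A is
   a bijection from A onto [B]_0. *)
Definition standard gB : Prop :=
  [/\ injective (fun a : A => a%:A : B),
      gB 0 = range (fun a : A => a%:A : B)
    & exists (k : nat) (x : 'I_k -> B),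
        (forall j, exists i : 'I_r, gB (nunit i) (x j)) /\
        (forall S : set B, is_subalgebra S -> (forall j, S (x j)) -> S = setT)].

Definition graded_module gB (M : lmodType B) (gM : zvec r -> set M) : Prop :=
  direct_sum gM /\
  (forall n nu b m, gB n b -> gM nu m -> gM (zvec_of n + nu) (b *: m)).

Definition hilbert_series (M : lmodType B) (gM : zvec r -> set M)
    (H : zvec r -> nat) : Prop :=
  forall nu, length_A (gM nu) (H nu).

End Gradings.

(* Laurent polynomials in t_1, ..., t_r over int: Q@_nu is the coefficient of
   t^nu. The library puts no ring structure on {malg int[K]} for this K, as its
   monomial types have no nontrivial units. *)
Notation laurent r := {malg int[zvec r]}.

Section Laurent.
Variable r : nat.

Definition laurent_mul (P Q : laurent r) : laurent r :=
  \sum_(a <- msupp P) \sum_(b <- msupp Q) << P@_a * Q@_b *g a + b >>.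

Definition eval_at_1 (Q : laurent r) : int := \sum_(nu <- msupp Q) Q@_nu.

Definition one_minus_t (i : 'I_r) : laurent r :=
  << 0%R >> - << zvec_of (nunit i) >>.

Definition laurent_dvd (P Q : laurent r) : Prop :=
  exists R : laurent r, Q = laurent_mul P R.

(* The coefficient of t^m in 1 / (1 - t)^k: multiplying a power series by
   1 + t + t^2 + ... takes partial sums of its coefficients. *)
Fixpoint geom_coef (k m : nat) : nat :=
  if k is k'.+1 then (\sum_(j < m.+1) geom_coef k' j)%N else nat_of_bool (m == 0%N).

(* The coefficient of t^nu in 1 / ((1 - t_1)^(n_1) ... (1 - t_r)^(n_r)). *)
Definition inv_denom (n : nvec r) (nu : zvec r) : int :=
  \prod_(i < r) (if nu i is Posz m then (geom_coef (n i) m)%:Z else 0).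

(* The coefficient of t^nu in Q * F, where F is the formal series with
   coefficients F. *)
Definition series_mul (Q : laurent r) (F : zvec r -> int) (nu : zvec r) : int :=
  \sum_(mu <- msupp Q) Q@_mu * F (nu - mu).

End Laurent.

(* Main.v *)
(* Over the Artinian ring [A], the algebra [B] is noetherian, so its homogeneous
   ideals [I] can be treated by noetherian induction: [B/I] has Hilbert series
   [sum_k t^(a_k) / (1-t)^(n_k)] in which each [|n_k|] is the length of some chain
   of primes over [I].  If [ab] is in [I] with [a], [b] homogeneous outside [I],
   add the sums for [I : a], shifted by [deg a], and [I + (a)].  If [I] is prime
   and misses a generator [x] of degree [e_i], divide the sum for [I + (x)] by
   [1 - t_i] and prepend [I] to the chains.  If [I] is prime and contains all
   generators, [B/I] has finite length and is concentrated in degree 0.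
   Filtering [M] by cyclic modules [B/I(a)] gives such a sum for [M], with all
   [|n_k| <= d].  Conversely, a chain of [d] primes forces the length of the part
   of [M] in a box of size [s] to grow at least like [s^d], so some [|n_k| >= d].
   The terms with [|n_k| = d] have numerators with positive value at 1, and the
   others become multiples of [1 - t_1] once brought to pole order [d]. *)
Require Import Defs.
From HB Require Import structures.
From mathcomp Require Import all_boot all_order all_algebra finmap monalg.
From mathcomp Require Import boolp classical_sets fsbigop.
From mathcomp Require Import zify ring.
Import Order.TTheory GRing.Theory Num.Theory.
Local Open Scope classical_set_scope.
Local Open Scope ring_scope.

Set Implicit Arguments.
Unset Strict Implicit.
Unset Printing Implicit Defensive.

(** * Chains and lengths of submodules *)

Section Chains.
Context {T : Type}.
Implicit Types (P : set (set T)) (C : nat -> set T).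

(** No quotient module is ever formed: lengths are suprema of chains between two submodules, so an
    exact sequence becomes additivity along [K], [L], [N] together with a transport of one interval
    to another. The sequence used throughout is [0 -> B/(I : a) -> B/I -> B/(I + (a)) -> 0], with
    the first term shifted by the degree of [a]. If [I] is prime and [x] lies outside it, then
    [(I : x) = I]; this is where the division by [1 - t_i] comes from. The series is kept as a list
    of monomials over denominators, all with coefficient 1. Nothing can cancel, and the value at 1
    of a numerator becomes a count of terms, which gives both its sign and the meaning of its
    vanishing. Attaching a chain of primes to every term bounds pole orders by [d] without any prior
    link between dimension and Hilbert functions. That bound alone would allow all poles to have
    order below [d], hence the separate growth argument. *)

Definition chain P C l :=
  (forall i, (i <= l)%N -> P (C i)) /\ (forall i, (i < l)%N -> C i `<` C i.+1).

(** The junction may be an equality, so [C' 0] is dropped and [C a] is followed by [C' 1]; hence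
    exactly [a + b] strict steps. *)
Lemma chain_cat P C C' a b :
  chain P C a -> chain P C' b -> C a `<=` C' 0%N -> has_chain P (a + b).
Proof.
move=> [PC CC] [PC' CC'] sub.
exists (fun i => if (i <= a)%N then C i else C' (i - a)%N); split=> i il.
  by case: ifP => ia; [exact: PC | apply: PC'; lia].
case: (ltngtP i a) => ia; first exact: CC.
- have -> : (i.+1 - a = (i - a).+1)%N by lia.
  by apply: CC'; lia.
- rewrite ia subSn // subnn -ia.
  have /CC' [s01 n01] : (0 < b)%N by lia.
  rewrite ia in sub *; split; first exact: subset_trans sub s01.
  by move=> h; apply: n01; apply: subset_trans h sub.
Qed.

Lemma has_chain_sub P P' l : P `<=` P' -> has_chain P l -> has_chain P' l.
Proof. by move=> sub [C [PC CC]]; exists C; split=> // i /PC /sub. Qed.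

Lemma has_chain0 P X : P X -> has_chain P 0.
Proof. by move=> PX; exists (fun=> X); split=> i; rewrite ?ltn0. Qed.

(** Repetitions are deleted. This serves chains pushed through an intersection or a sum, where some
    steps collapse. *)
Lemma weak_chain P C l : (forall i, (i <= l)%N -> P (C i)) ->
  (forall i, (i < l)%N -> C i `<=` C i.+1) ->
  has_chain P (\sum_(i < l) `[< C i <> C i.+1 >])%N.
Proof.
move=> PC CC.
(* The induction must also know that the pruned chain ends at [C l], where the next step is
   attached. *)
suff [D cD _] : exists2 D, chain P D (\sum_(i < l) `[< C i <> C i.+1 >])%N
    & D (\sum_(i < l) `[< C i <> C i.+1 >])%N = C l by exists D.
elim: l PC CC => [|l IH] PC CC.
  rewrite big_ord0; exists (fun=> C 0%N) => //; split => i; rewrite ?ltn0 // => _.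
  exact: PC.
case: IH => [i il|i il|D [PD DD] Dl]; [by apply: PC; lia | by apply: CC; lia|].
rewrite big_ord_recr /=; set s := (\sum_(_ < _) _)%N in PD DD Dl *.
case: asboolP => [ne|/contrapT e]; rewrite ?addn0 ?addn1; last first.
  by exists D; rewrite ?Dl.
exists (fun i => if (i <= s)%N then D i else C l.+1); last by rewrite ltnn.
split=> i il.
  by case: ifP => // ?; [exact: PD | exact: PC].
rewrite -ltnS il; case: ifP => is'; first exact: DD.
have -> : i = s by lia.
split; rewrite Dl; first exact: CC.
by move=> h; apply: ne; apply/seteqP; split => //; apply: CC.
Qed.

Lemma sup_chain_exists P b :
  has_chain P 0 -> (forall l, has_chain P l -> (l <= b)%N) ->
  exists l, sup_chain_length P l.
Proof.
move=> P0 bd.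
have ex : exists l, `[< has_chain P l >] by exists 0%N; apply/asboolP.
have bd' l : `[< has_chain P l >] -> (l <= b)%N by move=> /asboolP /bd.
case: (ex_maxnP ex bd') => l /asboolP Pl lmax; exists l; split=> // l' Pl'.
by apply: lmax; apply/asboolP.
Qed.

End Chains.

Lemma has_chain_map (T T' : Type) (P : set (set T)) (P' : set (set T'))
    (f : set T -> set T') l :
  (forall X, P X -> P' (f X)) ->
  (forall X Y, P X -> P Y -> X `<=` Y -> f X `<=` f Y) ->
  (forall X Y, P X -> P Y -> X `<=` Y -> f Y `<=` f X -> Y `<=` X) ->
  has_chain P l -> has_chain P' l.
Proof.
move=> fP fS fI [C [PC CC]]; exists (f \o C); split=> i il /=.
  exact/fP/PC.
have [sub ne] := CC i il; have PCi := PC i (ltnW il); have PCi1 := PC i.+1 il.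
split; first exact: fS.
by move=> e; apply: ne; apply: fI.
Qed.

Section Submodules.
Context {S : Type} {V : zmodType}.
Variable act : S -> V -> V.
Implicit Types K L N : set V.

(** The action is an arbitrary map, so ideals, [A]-submodules and [B]-submodules are instances of
    one notion. *)
Definition submodule N :=
  [/\ N 0, forall x y, N x -> N y -> N (x - y) & forall s x, N x -> N (act s x)].

(** These are the submodules of [N / K], and [len K N] is the length of that quotient. *)
Definition between K N : set (set V) :=
  [set L | [/\ submodule L, K `<=` L & L `<=` N]].

Definition len K N l := sup_chain_length (between K N) l.

Definition msum K N : set V := [set x | exists k n, [/\ K k, N n & x = k + n]].

Lemma submodule0 N : submodule N -> N 0. Proof. by case. Qed.
Lemma submoduleB N x y : submodule N -> N x -> N y -> N (x - y).
Proof. by case=> _ + _; apply. Qed.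
Lemma submoduleN N x : submodule N -> N x -> N (- x).
Proof. by move=> sN Nx; rewrite -sub0r; apply: submoduleB => //; apply: submodule0. Qed.
Lemma submoduleD N x y : submodule N -> N x -> N y -> N (x + y).
Proof. by move=> sN Nx Ny; rewrite -[y]opprK; apply: submoduleB => //; apply: submoduleN. Qed.
Lemma submodule_act N s x : submodule N -> N x -> N (act s x).
Proof. by case=> _ _; apply. Qed.

Lemma submodule_sum N (I : eqType) (r : seq I) (F : I -> V) : submodule N ->
  (forall i, i \in r -> N (F i)) -> N (\sum_(i <- r) F i).
Proof.
move=> sN NF; rewrite big_seq; apply: (big_ind N) => //.
- exact: submodule0.
- by move=> x y; apply: submoduleD.
Qed.

Lemma submoduleI K N : submodule K -> submodule N -> submodule (K `&` N).
Proof.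
move=> sK sN; split=> [|x y [? ?] [? ?]|s x [? ?]]; split;
  by [apply: submodule0 | apply: submoduleB | apply: submodule_act].
Qed.

Lemma submoduleT : submodule setT. Proof. by []. Qed.

Lemma len_refl K : submodule K -> len K K 0.
Proof.
move=> sK; split; first by apply: (@has_chain0 _ _ K); split.
move=> [|l] // [C [PC CC]]; exfalso.
have [_ s0 s0'] := PC 0%N isT; have [_ s1 s1'] := PC 1%N isT.
by have [_] := CC 0%N isT; apply; apply: subset_trans s1' s0.
Qed.

Lemma fin_len_sub K N K' N' l : submodule K' -> K' `<=` N' -> K `<=` K' -> N' `<=` N ->
  len K N l -> exists l', len K' N' l'.
Proof.
move=> sK KN' KK' NN' [_ bd]; apply: (@sup_chain_exists _ _ l).
  by apply: (@has_chain0 _ _ K'); split.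
move=> l' c; apply: bd; apply: has_chain_sub c => L [sL KL LN]; split=> //.
  exact: subset_trans KL.
exact: subset_trans NN'.
Qed.

Hypothesis actD : forall s, {morph act s : x y / x + y}.

Lemma submodule_msum K N : submodule K -> submodule N -> submodule (msum K N).
Proof.
move=> sK sN; split.
- by exists 0, 0; rewrite addr0; split=> //; apply: submodule0.
- move=> _ _ [k [n [Kk Nn ->]]] [k' [n' [Kk' Nn' ->]]].
  by exists (k - k'), (n - n'); split; [apply: submoduleB|apply: submoduleB|rewrite opprD addrACA].
- move=> s _ [k [n [Kk Nn ->]]]; exists (act s k), (act s n).
  by split; [apply: submodule_act|apply: submodule_act|apply: actD].
Qed.

Lemma sub_msuml K N : submodule N -> K `<=` msum K N.
Proof. by move=> sN x Kx; exists x, 0; rewrite addr0; split=> //; apply: submodule0. Qed.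

Lemma sub_msumr K N : submodule K -> N `<=` msum K N.
Proof. by move=> sN x Kx; exists 0, x; rewrite add0r; split=> //; apply: submodule0. Qed.

Lemma msum_sub K N L : submodule L -> K `<=` L -> N `<=` L -> msum K N `<=` L.
Proof. by move=> sL KL NL _ [k [n [/KL ? /NL ? ->]]]; apply: submoduleD. Qed.

Lemma msum_sub2 K K' N : K `<=` K' -> msum K N `<=` msum K' N.
Proof. by move=> s _ [k [n [/s ? ? ->]]]; exists k, n. Qed.

Lemma has_chain_between K L N a b : K `<=` L -> L `<=` N ->
  has_chain (between K L) a -> has_chain (between L N) b ->
  has_chain (between K N) (a + b).
Proof.
move=> KL LN [C cC] [C' cC'].
have inC : chain (between K N) C a.
  case: cC => PC CC; split => // i /PC [? ? ?]; split=> //.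
  exact: subset_trans LN.
have inC' : chain (between K N) C' b.
  case: cC' => PC CC; split => // i /PC [? ? ?]; split=> //.
  exact: subset_trans KL _.
apply: (chain_cat inC inC').
have [_ _] := cC.1 a (leqnn a); have [_ + _] := cC'.1 0%N isT.
by move=> h1 h2; apply: subset_trans h1.
Qed.

Lemma len_add K L N a b : submodule L -> submodule N -> K `<=` L ->
  L `<=` N -> len K L a -> len L N b -> len K N (a + b).
Proof.
move=> sL sN KL LN [cA bdA] [cB bdB]; split; first exact: has_chain_between cA cB.
move=> l [D [PD DD]].
have sub i : (i < l)%N -> D i `<=` D i.+1 by move=> /DD [].
(* A chain [D] is compared with its traces in [L / K] and [N / L]. If a step collapses both after
   intersecting with [L] and after adding [L], the modular law makes it an equality, so every step
   survives in at least one trace. *)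
have c1 := @weak_chain _ (between K L) (fun i => D i `&` L) l.
have c2 := @weak_chain _ (between L N) (fun i => msum (D i) L) l.
apply: leq_trans (leq_add (bdA _ (c1 _ _)) (bdB _ (c2 _ _))).
- rewrite -big_split /= -[X in (X <= _)%N]card_ord -sum1_card; apply: leq_sum => i _.
  case: asboolP => [_|/contrapT e1]; first by [].
  case: asboolP => [_|/contrapT e2]; first by [].
  have [Dsub ne] := DD i (ltn_ord i); case: ne.
  have [sDi _ _] := PD i (ltnW (ltn_ord i)); have [sDi1 _ _] := PD i.+1 (ltn_ord i).
  move=> x Dx.
  have : msum (D i.+1) L x by apply: sub_msuml.
  rewrite -e2 => -[k [n [Dk Ln xE]]].
  have : (D i.+1 `&` L) n.
    split=> //; have -> : n = x - k by rewrite xE addrC addKr.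
    by apply: submoduleB => //; apply: Dsub.
  by rewrite -e1 => -[Dn _]; rewrite xE; apply: submoduleD.
- move=> i /PD [sD KD DN]; split; first exact: submoduleI.
    by move=> x Kx; split; [exact: KD | exact: KL].
  by move=> x [].
- by move=> i /sub s x [/s ? ?]; split.
- move=> i /PD [sD KD DN]; split; first exact: submodule_msum.
    exact: sub_msumr.
  exact: msum_sub.
- by move=> i /sub s; apply: msum_sub2.
Qed.

End Submodules.

(** The hypotheses say that [f] induces an isomorphism of [N / K] onto [N' / K']. Chains travel
    along [g L = f(L) + K'] and along [h L], the preimage of [L] in [N]. *)
Lemma len_isom (S : Type) (V V' : zmodType) (act : S -> V -> V)
    (act' : S -> V' -> V') (f : V -> V') K N K' N' l :
  {morph f : x y / x - y} -> (forall s x, f (act s x) = act' s (f x)) ->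
  (forall s, {morph act' s : x y / x + y}) ->
  submodule act N -> submodule act' K' -> submodule act' N' -> K' `<=` N' ->
  K `<=` N -> (forall x, N x -> K' (f x) <-> K x) ->
  (forall x, N x -> N' (f x)) ->
  (forall y, N' y -> exists2 x, N x & K' (y - f x)) ->
  len act K N l <-> len act' K' N' l.
Proof.
move=> fB f_act act'D sN sK' sN' KN' KN fK fN fS.
have f0 : f 0 = 0 by rewrite -(subr0 0) fB subrr.
suff ext m : has_chain (between act K N) m <-> has_chain (between act' K' N') m.
  by split=> -[c bd]; split=> [|m /ext cm]; [apply/ext|apply: bd|apply/ext|apply: bd].
pose g (L : set V) : set V' := [set y | exists2 x, L x & K' (y - f x)].
pose h (L : set V') : set V := [set x | N x /\ L (f x)].
have sg L : between act K N L -> between act' K' N' (g L).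
  move=> [sL KL LN]; split.
  - split.
    + by exists 0; [exact: submodule0 sL | rewrite f0 subr0; exact: submodule0 sK'].
    + move=> y y' [x Lx e] [x' Lx' e']; exists (x - x'); first exact: submoduleB sL _ _.
      have -> : y - y' - f (x - x') = (y - f x) - (y' - f x').
        by rewrite fB !opprB addrACA [RHS]addrACA; congr (_ + _); rewrite addrC.
      exact: submoduleB sK' _ _.
    + move=> s y [x Lx e]; exists (act s x); first exact: submodule_act sL _.
      have -> : act' s y - f (act s x) = act' s (y - f x).
        apply/eqP; rewrite subr_eq f_act -act'D; apply/eqP; congr act'.
        by rewrite subrK.
      exact: submodule_act sK' _.
  - move=> y Ky; exists 0; first exact: submodule0 sL.
    by rewrite f0 subr0.
  - move=> y [x /LN Nx /KN' e]; rewrite -(subrK (f x) y).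
    by apply: submoduleD sN' _ _ => //; apply: fN.
have sh L : between act' K' N' L -> between act K N (h L).
  move=> [sL KL LN]; split.
  - split.
    + by split; [exact: submodule0 sN | rewrite f0; exact: submodule0 sL].
    + move=> x x' [Nx Lx] [Nx' Lx']; split; first exact: submoduleB sN _ _.
      by rewrite fB; exact: submoduleB sL _ _.
    + move=> s x [Nx Lx]; split; first exact: submodule_act sN _.
      by rewrite f_act; exact: submodule_act sL _.
  - by move=> x Kx; split; [apply: KN | apply: KL; apply/fK => //; apply: KN].
  - by move=> x [].
split; [apply: (@has_chain_map _ _ _ _ g) => // | apply: (@has_chain_map _ _ _ _ h) => //].
- by move=> X Y _ _ XY y [x /XY Yx e]; exists x.
- move=> X Y [sX KX XN] [sY KY YN] XY gYX x Yx.
  have [|x' Xx' e] := gYX (f x).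
    by exists x => //; rewrite subrr; exact: submodule0 sK'.
  rewrite -(subrK x' x); apply: submoduleD sX _ _ => //; apply: KX.
  by apply/fK; [apply: submoduleB sN _ _; [exact: YN|exact: XN] | rewrite fB].
- by move=> X Y _ _ XY x [Nx /XY].
- move=> X Y [sX KX XN] [sY KY YN] XY hYX y Yy.
  have [x Nx e] := fS y (YN y Yy).
  have Yx : Y (f x).
    rewrite -[f x](subKr y); apply: submoduleB sY _ _ => //; exact: KY.
  have [_ Xx] : h X x by apply: hYX.
  by rewrite -(subrK (f x) y); apply: submoduleD sX _ _ => //; exact: KX.
Qed.

(** * Artinian and noetherian rings *)

Lemma well_founded_noseq (T : Type) (R : T -> T -> Prop) :
  (forall u : nat -> T, ~ forall k, R (u k.+1) (u k)) -> well_founded R.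
Proof.
move=> noseq x; apply: contrapT => nAx.
have next (y : {y | ~ Acc R y}) : {z : {y | ~ Acc R y} | R (sval z) (sval y)}.
  case: y => y nAy /=; apply: cid; apply: contrapT => h; apply: nAy.
  constructor => z zy; apply: contrapT => nAz; apply: h.
  by exists (exist _ z nAz).
pose u k := iter k (fun y => sval (next y)) (exist _ x nAx).
by apply: (noseq (fun k => sval (u k))) => k; exact: (svalP (next (u k))).
Qed.

Section Ideals.
Variable R : comNzRingType.
Implicit Types I J : set R.

Local Notation ideal := (submodule (@GRing.mul R)).

Lemma is_idealP I : is_ideal I <-> ideal I.
Proof.
split=> [[I0 ID IM]|sI]; split=> //.
- by move=> x y Ix Iy; apply: ID => //; rewrite -mulN1r; apply: IM.
- exact: submodule0 sI.
- by move=> x y; apply: submoduleD sI.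
- by move=> a x; apply: submodule_act.
Qed.

Lemma mulmD (s : R) : {morph *%R s : x y / x + y}.
Proof. exact: mulrDr. Qed.

Lemma artinian_wf : artinian_ring R ->
  well_founded (fun I J : {I : set R | ideal I} => sval I `<` sval J).
Proof.
move=> art; apply: well_founded_noseq => u dec.
have [k|k|k0 /(_ k0.+1 (leqnSn _)) e] := art (fun k => sval (u k)).
- by apply/is_idealP; exact: (svalP (u k)).
- by have [] := dec k.
- by have [_] := dec k0; rewrite e; apply.
Qed.

Definition noetherian := forall I : nat -> set R, (forall k, ideal (I k)) ->
  (forall k, I k `<=` I k.+1) -> exists k0, forall k, (k0 <= k)%N -> I k = I k0.

Lemma noetherian_wf : noetherian ->
  well_founded (fun I J : {I : set R | ideal I} => sval J `<` sval I).
Proof.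
move=> art; apply: well_founded_noseq => u dec.
have [k|k|k0 /(_ k0.+1 (leqnSn _)) e] := art (fun k => sval (u k)).
- exact: (svalP (u k)).
- by have [] := dec k.
- by have [_] := dec k0; rewrite e; apply.
Qed.

Let zero_ideal : ideal [set 0].
Proof.
split=> // [x y|s x] /= -> => [->|]; [by rewrite subrr | by rewrite mulr0].
Qed.

Lemma ideal_avoiding I v : ideal I -> v != 0 ->
  exists J, [/\ ideal J, J `<=` I, ~ J v
    & forall K, ideal K -> J `<` K -> K `<=` I -> K v].
Proof.
move=> sI v0.
(* Membership of 0 is left out because Zorn's lemma also asks for the union of the empty family. It
   is recovered from maximality: an empty [J] would be enlarged by the zero ideal, which avoids
   [v]. *)
pose P (J : set R) := [/\ J `<=` I, ~ J v, forall x y, J x -> J y -> J (x - y)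
                                  & forall a x, J x -> J (a * x)].
have [F FP tot|J [[JI nJv JB JM] Jmax]] := @Zorn_bigcup R P.
  split.
  - by move=> x [X /FP[XI _ _ _] /XI].
  - by move=> [X /FP[]].
  - move=> x y [X FX Xx] [Y FY Yy].
    have [XY|YX] := tot _ _ FX FY.
      by exists Y => //; have [_ _ YB _] := FP _ FY; apply: YB => //; apply: XY.
    by exists X => //; have [_ _ XB _] := FP _ FX; apply: XB => //; apply: YX.
  - by move=> a x [X FX Xx]; exists X => //; have [_ _ _ XM] := FP _ FX; apply: XM.
exists J; split=> //; last first.
  move=> K [K0 KB KM] JK KI; apply: contrapT => nKv; exact: (Jmax K).
split=> //.
have [[x Jx]|nJ] := pselect (exists x, J x); first by rewrite -(subrr x); apply: JB.
exfalso; apply: (Jmax [set 0]).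
  by split=> [x Jx|h]; [case: nJ; exists x | apply: nJ; exists 0; apply: h].
have [z1 z2 z3] := zero_ideal.
split=> //; first by move=> _ ->; exact: submodule0 sI.
by move=> /= e; rewrite e eqxx in v0.
Qed.

(** The ideals generated by the powers of [a] stabilize, so some [a ^+ n] is a multiple
    [c * a ^+ n.+1]. *)
Lemma artinian_quasi_inverse (art : artinian_ring R) (a : R) :
  exists n c, a ^+ n * (1 - c * a) = 0.
Proof.
pose I k : set R := [set x | exists c, x = c * a ^+ k].
have [k|k|k0 /(_ k0.+1 (leqnSn _)) e] := art I.
- apply/is_idealP; split; first by exists 0; rewrite mul0r.
    by move=> _ _ [c ->] [c' ->]; exists (c - c'); rewrite mulrBl.
  by move=> s _ [c ->]; exists (s * c); rewrite mulrA.
- by move=> _ [c ->]; exists (c * a); rewrite exprS mulrA.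
- have : I k0 (a ^+ k0) by exists 1; rewrite mul1r.
  rewrite -e => -[c ce]; exists k0, c.
  by rewrite mulrBr mulr1 {1}ce exprS; ring.
Qed.

(* A minimal ideal [I] of infinite length is either killed or reproduced by each
   [a], so it is a vector space over a field; a complement [J] of a line in it
   is then a smaller ideal of infinite length. *)
Lemma artinian_fin_len : artinian_ring R ->
  exists l, len *%R [set 0 : R] setT l.
Proof.
move=> art.
suff h (I : {I : set R | ideal I}) : exists l, len *%R [set 0 : R] (sval I) l.
  by apply: (h (exist _ _ (submoduleT *%R))).
elim: I / (artinian_wf art I) => -[I sI] _ /= IH.
apply: contrapT => nfl.
have {}IH J : ideal J -> J `<` I -> exists l, len *%R [set 0] J l.
  by move=> sJ; apply: (IH (exist _ J sJ)).
have sub0 J : ideal J -> [set 0] `<=` J by move=> sJ _ ->; exact: submodule0 sJ.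
have trans J l : ideal J -> J `<` I -> ~ len *%R J I l.
  move=> sJ JI lJI; have [l' l'E] := IH J sJ JI; apply: nfl.
  by exists (l' + l)%N; apply: (len_add mulmD _ _ _ _ l'E lJI) => //; [exact: sub0|case: JI].
(* If [a I] is smaller than [I], minimality gives it finite length, and it is isomorphic to [I / Z]
   with [Z] the kernel of [a] on [I]. A proper [Z] would have finite length too, and then so would
   [I]. *)
have dich a : (forall y, I y -> exists2 x, I x & y = a * x) \/
              (forall x, I x -> a * x = 0).
  pose aI : set R := [set y | exists2 x, I x & y = a * x].
  have saI : ideal aI.
    split; first by exists 0; [exact: submodule0 sI | rewrite mulr0].
      move=> _ _ [x Ix ->] [y Iy ->]; exists (x - y); first exact: submoduleB sI _ _.
      by rewrite mulrBr.
    by move=> s _ [x Ix ->]; exists (s * x); [exact: submodule_act sI _ | ring].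
  have [|naI] := pselect (I `<=` aI); [by left | right].
  have aII : aI `<=` I by move=> _ [x Ix ->]; exact: submodule_act sI _.
  have [l laI] := IH aI saI (conj aII naI).
  pose Z : set R := [set x | I x /\ a * x = 0].
  have sZ : ideal Z.
    split; first by split; [exact: submodule0 sI | rewrite mulr0].
      move=> x y [Ix ex] [Iy ey]; split; first exact: submoduleB sI _ _.
      by rewrite mulrBr ex ey subrr.
    move=> s x [Ix ex]; split; first exact: submodule_act sI _.
    by rewrite mulrCA ex mulr0.
  apply: contrapT => nkill; apply: (trans Z l sZ).
    split; first by move=> x [].
    by move=> IZ; apply: nkill => x /IZ [].
  apply/(@len_isom R R R *%R *%R ( *%R a) Z I [set 0] aI l) => //.
  - by move=> x y; apply: mulrBr.
  - by move=> s x; apply: mulrCA.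
  - exact: mulmD.
  - exact: sub0.
  - by move=> x [].
  - by move=> x Ix; split=> [e|[]].
  - by move=> x Ix; exists x.
  - by move=> _ [x Ix ->]; exists x => //=; rewrite subrr.
(* When [a I = I], each [x] in [I] is of the form [a ^+ n * y], and [1 - c * a] kills such elements;
   so [c] inverts [a] on [I]. *)
have unit_mod a : ~ (forall x, I x -> a * x = 0) ->
    exists c, forall x, I x -> c * a * x = x.
  move=> na; have [n [c ce]] := artinian_quasi_inverse art a; exists c => x Ix.
  have [surj|//] := dich a.
  have surjn m y : I y -> exists2 x, I x & y = a ^+ m * x.
    elim: m y => [|m IHm] y Iy; first by exists y; rewrite ?expr0 ?mul1r.
    have [z Iz ->] := surj y Iy; have [w Iw ->] := IHm z Iz.
    by exists w => //; rewrite exprS mulrA.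
  have [y Iy ->] := surjn n x Ix.
  apply/eqP; rewrite -subr_eq0; apply/eqP.
  have -> : c * a * (a ^+ n * y) - a ^+ n * y = - (a ^+ n * (1 - c * a) * y) by ring.
  by rewrite ce mul0r oppr0.
have [v Iv v0] : exists2 v, I v & v != 0.
  apply: contrapT => h; apply: nfl; exists 0%N.
  have -> : I = [set 0].
    apply/seteqP; split=> [x Ix|]; last exact: sub0.
    by apply: contrapT => x0; apply: h; exists x => //; apply/eqP.
  exact: len_refl.
have [J [sJ JI nJv Jmax]] := ideal_avoiding sI v0.
(* The quotient [I / J] is simple. An ideal [K] strictly above [J] contains [v]; for [w] in [I]
   outside [J], maximality gives [v = j + a * w], where [a] does not kill [I], so [w] is recovered
   from [v - j] by the inverse of [a]. *)
have full K u : ideal K -> J `<=` K -> K `<=` I -> K u -> ~ J u -> I `<=` K.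
  move=> sK JK KI Ku nJu.
  have Kv : K v.
    by apply: Jmax => //; split=> // KJ; apply: nJu; apply: KJ.
  move=> w Iw; have [/JK //|nJw] := pselect (J w).
  pose Aw : set R := [set y | exists c, y = c * w].
  have sAw : ideal Aw.
    split; first by exists 0; rewrite mul0r.
      by move=> _ _ [c ->] [c' ->]; exists (c - c'); rewrite mulrBl.
    by move=> s _ [c ->]; exists (s * c); rewrite mulrA.
  have [] : msum J Aw v.
    apply: Jmax; first exact: submodule_msum mulmD _ _ _ _.
      split; first exact: sub_msuml sAw.
      move=> sub; apply: nJw; apply: sub; apply: (sub_msumr sJ).
      by exists 1; rewrite mul1r.
    by apply: (msum_sub sI) => // _ [c ->]; exact: submodule_act sI _.
  move=> j [_ [Jj [a ->] ve]].
  have [c ca] : exists c, forall x, I x -> c * a * x = x.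
    apply: unit_mod => kill; apply: nJv.
    by rewrite ve kill // addr0.
  rewrite -(ca w Iw) -mulrA; apply: (submodule_act _ sK).
  have -> : a * w = v - j by rewrite ve addrAC subrr add0r.
  by apply: (submoduleB sK) => //; exact: JK.
have [l lJI] : exists l, len *%R J I l.
  apply: (@sup_chain_exists _ _ 1); first by apply: (@has_chain0 _ _ J); split=> //; case: JI.
  move=> [|[|l]] // [C [PC CC]]; exfalso.
  have [_ JC0 _] := PC 0%N isT; have [sC1 JC1 C1I] := PC 1%N isT.
  have [_ _ C2I] := PC 2%N isT.
  have [_] := CC 1%N isT; apply; apply: subset_trans C2I _.
  have [_ ] := CC 0%N isT.
  move=> /existsNP[u /not_implyP[Cu nCu]].
  by apply: (full _ u) => //; contradict nCu; apply: JC0.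
by apply: (trans J l sJ _ lJI); split=> // IJ; apply: nJv; exact: IJ.
Qed.

Lemma artinian_noetherian : artinian_ring R -> noetherian.
Proof.
move=> art I sI incI; have [l [_ bd]] := artinian_fin_len art.
apply: contrapT => nstab.
have inc j k : (j <= k)%N -> I j `<=` I k.
  move=> /subnK <-; elim: (k - j)%N => [|m IHm]; first by rewrite add0n.
  exact: subset_trans IHm (incI _).
have next k : exists k', (k <= k')%N /\ I k `<` I k'.
  apply: contrapT => h; apply: nstab; exists k => k' kk'.
  apply/seteqP; split; last exact: inc.
  by apply: contrapT => nsub; apply: h; exists k'; split=> //; split=> //; exact: inc.
have [f fP] := choice next.
have : has_chain (between *%R [set 0 : R] setT) l.+1.
  exists (fun i => I (iter i f 0%N)); split=> i _ /=.
    by split=> // _ ->; exact: submodule0 (sI _).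
  by have [] := fP (iter i f 0%N).
by move=> /bd; rewrite ltnn.
Qed.

End Ideals.

(** * Hilbert's basis theorem and algebras of finite type *)

Local Notation ideal := (submodule *%R).

Lemma ideal_preimage (R R' : comNzRingType) (f : {rmorphism R -> R'}) (I : set R') :
  ideal I -> ideal [set x | I (f x)].
Proof.
move=> sI; split=> /= [|x y|s x]; first by rewrite rmorph0; exact: submodule0 sI.
  by rewrite rmorphB; exact: submoduleB sI.
by rewrite rmorphM; exact: submodule_act sI.
Qed.

Lemma noetherian_image (R R' : comNzRingType) (f : {rmorphism R -> R'}) :
  (forall y, exists x, y = f x) -> noetherian R -> noetherian R'.
Proof.
move=> fS noeR I sI incI.
have [k|k x|k0 k0P] := noeR (fun k => [set x | I k (f x)]).
- exact: ideal_preimage.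
- exact: incI.
- exists k0 => k /k0P e; apply/seteqP; split=> y; have [x ->] := fS y;
    by have := congr1 (fun P : set R => P x) e => /= ->.
Qed.

(** The ideal [L i n] collects the coefficients of [X^n] in the elements of [J i] of degree at most
    [n], and it grows with both [i] and [n]. Its diagonal stabilizes at some [k0], which settles all
    columns [n >= k0]; finitely many columns remain, each with its own threshold. *)
Lemma noetherian_poly (R : comNzRingType) : noetherian R -> noetherian {poly R}.
Proof.
move=> noeR J sJ incJ.
have inc j k : (j <= k)%N -> J j `<=` J k.
  move=> /subnK <-; elim: (k - j)%N => [|m IHm]; first by rewrite add0n.
  exact: subset_trans IHm (incJ _).
pose L i n : set R := [set c | exists p : {poly R}, [/\ J i p, (size p <= n.+1)%N & p`_n = c]].
have sL i n : ideal (L i n).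
  split.
  - by exists 0; rewrite size_poly0 coef0; split=> //; exact: submodule0 (sJ i).
  - move=> _ _ [p [Jp sp <-]] [q [Jq sq <-]]; exists (p - q); split.
    + exact: submoduleB (sJ i) _ _.
    + by rewrite (leq_trans (size_polyD _ _)) // geq_max sp size_polyN.
    + by rewrite coefB.
  - move=> s _ [p [Jp sp <-]]; exists (s%:P * p); split.
    + exact: submodule_act (sJ i) _.
    + by rewrite mul_polyC (leq_trans (size_scale_leq _ _)).
    + by rewrite coefCM.
have incL1 i i' n : (i <= i')%N -> L i n `<=` L i' n.
  by move=> ii' c [p [Jp sp e]]; exists p; split=> //; exact: inc Jp.
have incL2 i n n' : (n <= n')%N -> L i n `<=` L i n'.
  move=> nn' _ [p [Jp sp <-]]; exists ('X^(n' - n) * p); split.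
  - exact: submodule_act (sJ i) _.
  - have [->|p0] := eqVneq p 0; first by rewrite mulr0 size_poly0.
    by rewrite mulrC size_mulXn //; lia.
  - by rewrite mulrC coefMXn; case: ltnP => h; [lia | congr nth; lia].
have [k|k0 k0P] := noeR (fun k => L k k) (fun k => sL k k).
  by apply: subset_trans (incL1 _ k.+1 _ _) (incL2 _ _ _ _); rewrite leqnSn.
have col n : exists i, forall i', (i <= i')%N -> L i' n = L i n.
  by apply: (noeR (fun i => L i n)) => i; [exact: sL | apply: incL1].
have [t tP] := choice col.
pose i0 := (k0 + \sum_(n < k0) t n)%N.
have stab n i : (i0 <= i)%N -> L i n `<=` L i0 n.
  move=> i0i; have [nk|kn] := ltnP n k0.
    (* The sum of the thresholds is used as a common upper bound for all of them. *)
    have ti0 : (t n <= i0)%N.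
      by rewrite /i0 (bigD1 (Ordinal nk)) //=; lia.
    by rewrite (tP n i) ?(tP n i0) //; lia.
  apply: subset_trans (incL1 i (maxn i n) n _) _; first exact: leq_maxl.
  apply: subset_trans (incL2 (maxn i n) n (maxn i n) _) _; first exact: leq_maxr.
  rewrite k0P; last by rewrite leq_max kn orbT.
  apply: subset_trans (incL1 k0 i0 k0 _) (incL2 i0 k0 n kn).
  exact: leq_addr.
exists i0 => i i0i; apply/seteqP; split; last exact: inc.
(* An element [q] of [J i0] with the same leading term as [p] is subtracted, which lowers the
   size. *)
move=> p; have [m] := ubnP (size p); elim: m p => // m IHm p sp Jp.
have [->|p0] := eqVneq p 0; first exact: submodule0 (sJ i0).
have [q [Jq sq eq]] : L i0 (size p).-1 p`_(size p).-1.
  by apply: (stab _ i) => //; exists p; split=> //; exact: leqSpred.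
rewrite -(subrK q p); apply: submoduleD (sJ i0) _ _ => //; apply: IHm; last first.
  by apply: submoduleB (sJ i) _ _ => //; exact: inc Jq.
have sp0 : (0 < size p)%N by rewrite size_poly_gt0.
suff le : (size (p - q)%R <= (size p).-1)%N.
  by apply: leq_ltn_trans le _; move: sp sp0; case: (size p).
apply/leq_sizeP => j; rewrite leq_eqVlt coefB => /orP[/eqP <-|jp].
  by rewrite eq subrr.
have pj : (size p <= j)%N by move: sp0 jp; case: (size p).
by rewrite !nth_default ?subrr // (leq_trans sq) //; case: (size p) sp0 pj.
Qed.

(** One polynomial variable is adjoined for each element of [s], so the one-variable basis theorem
    can be iterated and multivariate polynomials are avoided. *)
Lemma noetherian_cover (R R' : comNzRingType) (f : {rmorphism R -> R'}) (s : seq R') :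
  noetherian R -> exists2 T : comNzRingType, noetherian T &
    exists g : {rmorphism T -> R'},
      (forall a, exists b, f a = g b) /\ (forall x, x \in s -> exists b, x = g b).
Proof.
elim: s R f => [|x s IHs] R f noeR.
  by exists R => //; exists f; split=> // a; exists a.
have cfx : commr_rmorph f x by move=> a; apply: mulrC.
pose h : {rmorphism {poly R} -> R'} := horner_morph cfx.
have [T noeT [g [g1 g2]]] := IHs _ h (noetherian_poly noeR).
exists T => //; exists g; split=> [a|y].
  by have [b e] := g1 a%:P; exists b; rewrite -e /h /= horner_morphC.
rewrite in_cons => /predU1P[->|/g2 //].
by have [b e] := g1 'X; exists b; rewrite -e /h /= horner_morphX.
Qed.

Lemma noetherian_fin_gen_alg (A : comNzRingType) (B : comAlgType A) k (x : 'I_k -> B) :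
  noetherian A ->
  (forall S : set B, is_subalgebra S -> (forall j, S (x j)) -> S = setT) ->
  noetherian B.
Proof.
move=> noeA gen.
have [T noeT [g [g1 g2]]] := noetherian_cover (in_alg B) (codom x) noeA.
apply: (@noetherian_image T B g) => // y.
suff -> : (exists x, y = g x) = [set: B] y by [].
rewrite -(gen [set z | exists b, z = g b]) //.
  split.
  - by move=> a; have [b e] := g1 a; exists b.
  - by move=> _ _ [b ->] [c ->]; exists (b + c); rewrite rmorphD.
  - by move=> _ _ [b ->] [c ->]; exists (b * c); rewrite rmorphM.
by move=> j; apply: g2; apply: codom_f.
Qed.

(** * Homogeneous components *)

Lemma sum_widen (D : eqType) (V : zmodType) (s t : seq D) (f : D -> V) :
  uniq s -> uniq t -> {subset s <= t} -> (forall n, n \notin s -> f n = 0) ->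
  \sum_(n <- t) f n = \sum_(n <- s) f n.
Proof.
move=> us ut st f0; rewrite [LHS](bigID (mem s)) /= [X in _ + X]big1 ?addr0; last first.
  by move=> n /f0.
rewrite -big_filter; apply: perm_big; apply: uniq_perm; rewrite ?filter_uniq //.
by move=> n; rewrite mem_filter andb_idr //; apply: st.
Qed.

Section Components.
Variables (D : eqType) (V : zmodType) (G : D -> set V).
Hypothesis dG : direct_sum G.

Let G0 n : G n 0. Proof. by have [/(_ n)[]] := dG. Qed.
Let GB n x y : G n x -> G n y -> G n (x - y).
Proof. by have [/(_ n)[_ h] _ _] := dG; apply: h. Qed.

(** A decomposition is a function on all degrees that vanishes off a finite list, so that uniqueness
    is an equality of functions and does not depend on the list. *)
Definition decomposes (v : V) (f : D -> V) := (forall n, G n (f n)) /\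
  exists s, [/\ uniq s, forall n, n \notin s -> f n = 0 & v = \sum_(n <- s) f n].

Lemma decomposes_ex v : exists f, decomposes v f.
Proof.
have [_ /(_ v)[s [c [us cG ->]]] _] := dG.
exists (fun n => if n \in s then c n else 0); split=> [n|]; first by case: ifP.
exists s; split=> // [n /negPf -> //|].
by apply: eq_big_seq => n ->.
Qed.

Lemma decomposes_unique v f f' : decomposes v f -> decomposes v f' -> f = f'.
Proof.
move=> [fG [s [us sf vs]]] [f'G [s' [us' sf' vs']]]; apply/funext => n.
have [_ _ ind] := dG; pose t := undup (s ++ s').
have ut : uniq t by apply: undup_uniq.
have e : \sum_(n <- t) (f n - f' n) = 0.
  rewrite sumrB (@sum_widen _ _ s) // ?(@sum_widen _ _ s' t) //.
  - by rewrite -vs -vs' subrr.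
  - by move=> x xs; rewrite mem_undup mem_cat xs orbT.
  - by move=> x xs; rewrite mem_undup mem_cat xs.
have [nt|] := boolP (n \in t).
  apply/eqP; rewrite -subr_eq0; apply/eqP.
  by apply: (ind t (fun n => f n - f' n)) => // m; exact: GB.
by rewrite mem_undup mem_cat negb_or => /andP[/sf -> /sf' ->].
Qed.

Definition hcomp (n : D) (v : V) : V := sval (cid (decomposes_ex v)) n.

Lemma hcompP v : decomposes v (hcomp^~ v).
Proof. exact: (svalP (cid (decomposes_ex v))). Qed.

Lemma hcompE v f n : decomposes v f -> hcomp n v = f n.
Proof. by move=> /(decomposes_unique (hcompP v)) <-. Qed.

Lemma hcomp_in n v : G n (hcomp n v). Proof. by have [] := hcompP v. Qed.

Lemma hcomp_sum v : exists s,
  [/\ uniq s, forall n, n \notin s -> hcomp n v = 0 & v = \sum_(n <- s) hcomp n v].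
Proof. by have [] := hcompP v. Qed.

Lemma hcompB n : {morph hcomp n : x y / x - y}.
Proof.
move=> x y; apply: (@hcompE _ (fun n => hcomp n x - hcomp n y)); split=> [m|].
  by apply: GB; exact: hcomp_in.
have [s [us s0 xE]] := hcomp_sum x; have [s' [us' s0' yE]] := hcomp_sum y.
exists (undup (s ++ s')); split; first exact: undup_uniq.
  by move=> m; rewrite mem_undup mem_cat negb_or => /andP[/s0 -> /s0' ->]; rewrite subrr.
have ut := undup_uniq (s ++ s'); rewrite sumrB; congr (_ - _).
  have st : {subset s <= undup (s ++ s')} by move=> m ms; rewrite mem_undup mem_cat ms.
  by rewrite (sum_widen us ut st s0) -xE.
have st : {subset s' <= undup (s ++ s')} by move=> m ms; rewrite mem_undup mem_cat ms orbT.
by rewrite (sum_widen us' ut st s0') -yE.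
Qed.

Lemma hcomp0 n : hcomp n 0 = 0.
Proof. by have := hcompB n 0 0; rewrite !subrr. Qed.

Lemma hcompN n : {morph hcomp n : x / - x}.
Proof. by move=> x; rewrite -[in LHS]sub0r hcompB hcomp0 sub0r. Qed.

Lemma hcompD n : {morph hcomp n : x y / x + y}.
Proof. by move=> x y; rewrite -{1}[y]opprK hcompB hcompN opprK. Qed.

Lemma hcomp_bigsum n (I : Type) (s : seq I) (F : I -> V) :
  hcomp n (\sum_(i <- s) F i) = \sum_(i <- s) hcomp n (F i).
Proof. exact: (big_morph _ (hcompD n) (hcomp0 n)). Qed.

Lemma hcomp_hom n m v : G m v -> hcomp n v = if n == m then v else 0.
Proof.
move=> Gv; apply: (@hcompE _ (fun n => if n == m then v else 0)); split=> [k|].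
  by case: eqP => [->|].
exists [:: m]; split=> // [k|]; first by rewrite inE => /negPf ->.
by rewrite big_seq1 eqxx.
Qed.

Lemma hcomp_id n v : G n v -> hcomp n v = v.
Proof. by move=> /hcomp_hom ->; rewrite eqxx. Qed.

End Components.

(** * Extension of the grading of [B] to integer degrees *)

Section NonnegativeDegrees.
Context {r : nat}.
Implicit Types (n : nvec r) (nu : zvec r).

(** Only a left inverse of [zvec_of]; the equation [nu = zvec_of (nabs nu)] tests that all entries
    are nonnegative. *)
Definition nabs nu : nvec r := [ffun i => `|nu i|%N].

Lemma zvec_ofK : cancel (@zvec_of r) nabs.
Proof. by move=> n; apply/ffunP => i; rewrite !ffunE. Qed.

Lemma zvec_ofD n n' : zvec_of (n + n') = zvec_of n + zvec_of n'.
Proof. by apply/ffunP => i; rewrite !ffunE. Qed.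

Lemma zvec_of0 : zvec_of 0 = 0 :> zvec r.
Proof. by apply/ffunP => i; rewrite !ffunE. Qed.

End NonnegativeDegrees.

Lemma graded_direct (r : nat) (A : comNzRingType) (B : comAlgType A)
    (gB : nvec r -> set B) (M : lmodType B) (gM : zvec r -> set M) :
  graded_module gB gM -> direct_sum gM.
Proof. by case. Qed.

Section ZGrading.
Variables (r : nat) (A : comNzRingType) (B : comAlgType A) (gB : nvec r -> set B).
Hypothesis gradedB : graded_algebra gB.

(** Extending by zero to negative degrees makes [B] a graded module over itself, so that results on
    graded modules apply to its homogeneous ideals and degree shifts need no side condition. *)
Definition zgrading (nu : zvec r) : set B^o :=
  [set x | if nu == zvec_of (nabs nu) then gB (nabs nu) x else x = 0].

Lemma zgradingE n : zgrading (zvec_of n) = gB n.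
Proof. by apply/seteqP; split=> x; rewrite /zgrading /= zvec_ofK eqxx. Qed.

Lemma zgradingP nu x : zgrading nu x -> x = 0 \/ exists2 n, nu = zvec_of n & gB n x.
Proof.
by rewrite /zgrading /=; case: eqP => [e gx|_ ->]; [right; exists (nabs nu) | left].
Qed.

Lemma zgrading_neg (nu : zvec r) i x : nu i < 0 -> zgrading nu x -> x = 0.
Proof. by move=> nui /zgradingP[//|[n nE _]]; move: nui; rewrite nE ffunE. Qed.

Let dB : direct_sum gB. Proof. by case: gradedB. Qed.

Lemma zgrading_direct : direct_sum zgrading.
Proof.
have [sub dec ind] := dB; split.
- move=> nu; rewrite /zgrading; case: eqP => /= _; first exact: sub.
  by split=> // x y -> ->; rewrite subrr.
- move=> v; have [s [c [us cG ->]]] := dec v.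
  exists (map (@zvec_of r) s),
    (fun nu => if nu == zvec_of (nabs nu) then c (nabs nu) else 0); split.
  + by rewrite map_inj_uniq //; exact: can_inj zvec_ofK.
  + by move=> nu; rewrite /zgrading /=; case: eqP.
  + by rewrite big_map; apply: eq_bigr => n _; rewrite zvec_ofK eqxx.
- move=> s c us cG c0 nu nus.
  have cpos mu : mu != zvec_of (nabs mu) -> c mu = 0.
    by move=> /negPf e; have := cG mu; rewrite /zgrading /= e.
  have [e|/eqP /cpos //] := pselect (nu = zvec_of (nabs nu)).
  rewrite e; apply: (ind (map nabs [seq mu <- s | mu == zvec_of (nabs mu)])
                         (fun n => c (zvec_of n))).
  + rewrite map_inj_in_uniq ?filter_uniq // => mu mu'.
    by rewrite !mem_filter => /andP[/eqP + _] /andP[/eqP + _] e2; rewrite e2 => -> <-.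
  + by move=> n; rewrite -zgradingE.
  + rewrite big_map big_filter -[RHS]c0 [in RHS](bigID (fun mu => mu == zvec_of (nabs mu))) /=.
    rewrite [X in _ + X]big1 ?addr0; last by move=> mu /cpos.
    by apply: eq_bigr => mu /eqP <-.
  + by apply/mapP; exists nu => //; rewrite mem_filter -e eqxx.
Qed.

Lemma zgrading_graded : graded_module gB zgrading.
Proof.
split; first exact: zgrading_direct.
move=> n nu b m gb /zgradingP[->|[k -> gm]].
  by rewrite scaler0; have [/(_ (zvec_of n + nu))[]] := zgrading_direct.
by rewrite -zvec_ofD zgradingE; have [_ _ _ gM] := gradedB; apply: gM.
Qed.

Lemma zgrading0_scalar (a : A) : zgrading 0 (a%:A : B).
Proof. by rewrite -zvec_of0 zgradingE; have [_ gZ g1 _] := gradedB; apply: gZ. Qed.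

End ZGrading.

(** * A total order on degrees compatible with addition *)

Section LexOrder.
Variable r : nat.
Implicit Types nu mu : zvec r.

Definition lex nu mu :=
  exists i : 'I_r, (forall j : 'I_r, (j < i)%N -> nu j = mu j) /\ nu i < mu i.

Lemma lex_trans nu mu xi : lex nu mu -> lex mu xi -> lex nu xi.
Proof.
move=> [i [ei li]] [j [ej lj]]; case: (ltngtP i j) => ij.
- exists i; split=> [k ki|]; first by rewrite ei ?ej //; lia.
  by rewrite -ej.
- exists j; split=> [k kj|]; first by rewrite ei ?ej //; lia.
  by rewrite ei.
- move/ord_inj: ij => ij; rewrite -ij in ej lj.
  by exists i; split=> [k ki|]; [rewrite ei ?ej | lia].
Qed.

Lemma lex_irr nu : ~ lex nu nu.
Proof. by move=> [i [_]]; rewrite ltxx. Qed.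

Lemma lex_total nu mu : nu <> mu -> lex nu mu \/ lex mu nu.
Proof.
move=> ne; have [i0 ni0] : exists i, nu i != mu i.
  apply: contrapT => h; apply: ne; apply/ffunP => i; apply/eqP.
  by apply: contrapT => /negP ni; apply: h; exists i.
case: (@arg_minnP _ i0 (fun i => nu i != mu i) (fun i : 'I_r => i : nat) ni0) => i ni imin.
have e (j : 'I_r) : (j < i)%N -> nu j = mu j.
  by move=> ji; apply/eqP; apply: contraTT ji => /imin; rewrite -leqNgt.
have [lt|gt|ee] := ltgtP (nu i) (mu i).
- by left; exists i.
- by right; exists i; split=> // j /e.
- by rewrite ee eqxx in ni.
Qed.

Lemma lex_max (s : seq (zvec r)) (P : zvec r -> Prop) : (exists2 nu, nu \in s & P nu) ->
  exists2 nu, P nu & forall mu, mu \in s -> P mu -> ~ lex nu mu.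
Proof.
elim: s => [|x s IH]; first by move=> [].
have [/IH [nu Pnu nuM] _|h [nu]] := pselect (exists2 nu, nu \in s & P nu).
  have [Px|nPx] := pselect (P x); last first.
    by exists nu => // mu; rewrite inE => /predU1P[->|/nuM //].
  have [lx|nlx] := pselect (lex nu x).
    exists x => // mu; rewrite inE => /predU1P[-> _|ms Pm]; first exact: lex_irr.
    by move=> lm; apply: (nuM mu ms Pm); exact: lex_trans lm.
  by exists nu => // mu; rewrite inE => /predU1P[->|/nuM].
rewrite inE => /predU1P[->|nus Pnu]; last by case: h; exists nu.
move=> Px; exists x => // mu; rewrite inE => /predU1P[->|ms Pm]; first by move=> _; exact: lex_irr.
by case: h; exists mu.
Qed.

Lemma lex_add nu mu xi : lex nu mu -> lex (nu + xi) (mu + xi).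
Proof.
move=> [i [e l]]; exists i; split=> [j ji|]; first by rewrite !ffunE e.
by rewrite !ffunE ltrD2r.
Qed.

End LexOrder.

(** * Homogeneous submodules, colon ideals and cyclic quotients *)

Section GradedModule.
Variables (r : nat) (A : comNzRingType) (B : comAlgType A) (gB : nvec r -> set B).
Hypothesis gradedB : graded_algebra gB.

Definition aact (M : lmodType B) (a : A) (m : M) : M := (a%:A : B) *: m.

Lemma aactD (M : lmodType B) a : {morph @aact M a : x y / x + y}.
Proof. by move=> x y; apply: scalerDr. Qed.

Local Notation bact M := (fun (b : B) (m : M) => b *: m).
Local Notation gZ := (zgrading gB).

Lemma bactD (M : lmodType B) b : {morph bact M b : x y / x + y}.
Proof. by move=> x y; apply: scalerDr. Qed.

Lemma submodule_aact (M : lmodType B) (N : set M) :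
  submodule (bact M) N -> submodule (@aact M) N.
Proof. by move=> [N0 NB NZ]; split=> // s x; apply: NZ. Qed.

Lemma is_AsubmoduleP (M : lmodType B) (N : set M) :
  is_Asubmodule (A := A) N <-> submodule (@aact M) N.
Proof.
split=> [[N0 ND NZ]|sN]; split=> //.
- move=> x y Nx Ny; apply: ND => //.
  by have := NZ (-1) y Ny; rewrite scaleNr scale1r scaleN1r.
- exact: submodule0 sN.
- by move=> x y; apply: submoduleD sN.
- by move=> a x; exact: (submodule_act a sN).
Qed.

Section Module.
Variables (M : lmodType B) (gM : zvec r -> set M).
Hypothesis gradedM : graded_module gB gM.

Local Notation dM := (graded_direct gradedM).
Local Notation dB := (graded_direct (zgrading_graded gradedB)).

Lemma gM0 nu : gM nu 0. Proof. by have [/(_ nu)[]] := dM. Qed.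
Lemma gMB nu x y : gM nu x -> gM nu y -> gM nu (x - y).
Proof. by have [/(_ nu)[_ h] _ _] := dM; apply: h. Qed.

Lemma gM_scale mu nu b m : gZ mu b -> gM nu m -> gM (mu + nu) (b *: m).
Proof.
move=> /zgradingP[->|[n -> gb]] gm; first by rewrite scale0r; exact: gM0.
by have [_ h] := gradedM; apply: h.
Qed.

Lemma submodule_gM nu : submodule (@aact M) (gM nu).
Proof.
split; [exact: gM0 | exact: gMB | move=> a x gx].
by rewrite -[nu]add0r; apply: gM_scale => //; exact: zgrading0_scalar.
Qed.

Lemma hcomp_scale_hom mu b nu m : gZ mu b -> hcomp dM nu (b *: m) = b *: hcomp dM (nu - mu) m.
Proof.
move=> gb; apply: (@hcompE _ _ _ dM _ (fun nu => b *: hcomp dM (nu - mu) m)); split=> [xi|].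
  by have := gM_scale gb (hcomp_in dM (xi - mu) m); rewrite addrC subrK.
have [s [us s0 mE]] := hcomp_sum dM m; exists (map (+%R mu) s); split.
- by rewrite map_inj_uniq //; exact: addrI.
- move=> xi xis; rewrite s0 ?scaler0 //; apply: contra xis => xis.
  by apply/mapP; exists (xi - mu) => //; rewrite addrC subrK.
- rewrite big_map {1}mE scaler_sumr; apply: eq_bigr => xi _.
  by rewrite addrAC subrr add0r.
Qed.

Lemma hcomp_scale nu g b xi : gM nu g -> hcomp dM xi (b *: g) = hcomp dB (xi - nu) b *: g.
Proof.
move=> gg; have [s [us s0 bE]] := hcomp_sum dB b.
rewrite {1}bE scaler_suml hcomp_bigsum.
have step mu : hcomp dM xi (hcomp dB mu b *: g) =
    if mu == xi - nu then hcomp dB mu b *: g else 0.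
  rewrite (hcomp_hom dM xi (gM_scale (hcomp_in dB mu b) gg)).
  by rewrite [mu == _]eq_sym subr_eq.
rewrite (eq_bigr _ (fun mu _ => step mu)) -big_mkcond /=.
have [ins|/[dup] nins /s0 ->] := boolP (xi - nu \in s).
  by rewrite (big_rem (xi - nu)) //= eqxx big1_seq ?addr0 // => mu /andP[/eqP ->]; rewrite mem_rem_uniqF.
rewrite scale0r big1_seq // => mu /andP[/eqP -> ins]; by rewrite ins in nins.
Qed.

Definition homog (K : set M) := forall nu v, K v -> K (hcomp dM nu v).

Definition colon (K : set M) (g : M) : set B := [set b | K (b *: g)].
Definition cyc (g : M) : set M := range (fun b : B => b *: g).

Lemma submodule_cyc g : submodule (bact M) (cyc g).
Proof.
split; first by exists 0; rewrite ?scale0r.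
  by move=> _ _ [b _ <-] [c _ <-]; exists (b - c); rewrite // scalerBl.
by move=> s _ [b _ <-]; exists (s * b); rewrite // scalerA.
Qed.

Lemma ideal_colon K g : submodule (bact M) K -> submodule *%R (colon K g).
Proof.
move=> sK; split; rewrite /colon /=.
- by rewrite scale0r; exact: submodule0 sK.
- by move=> x y Kx Ky; rewrite scalerBl; exact: submoduleB sK _ _.
- by move=> s x Kx; rewrite -scalerA; exact: (submodule_act s sK).
Qed.

Lemma homog_colon K g nu : homog K -> gM nu g ->
  forall mu b, colon K g b -> colon K g (hcomp dB mu b).
Proof.
move=> hK gg mu b Kb; rewrite /colon /=.
by have := hK (mu + nu) _ Kb; rewrite (hcomp_scale _ _ gg) addrK.
Qed.

Lemma homog_msum K g nu : submodule (bact M) K -> homog K -> gM nu g ->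
  homog (msum K (cyc g)).
Proof.
move=> sK hK gg xi _ [k [_ [Kk [b _ <-] ->]]].
rewrite hcompD (hcomp_scale _ _ gg); exists (hcomp dM xi k), (hcomp dB (xi - nu) b *: g).
by split; [exact: hK | exists (hcomp dB (xi - nu) b) | ].
Qed.

(** This is degree [xi] of the isomorphism [b |-> b *: g] from [B / (K : g)], shifted by the degree
    of [g], onto [(K + B g) / K]. *)
Lemma len_cyc K g nu xi l : submodule (bact M) K -> homog K -> gM nu g ->
  len (@aact M) (K `&` gM xi) (msum K (cyc g) `&` gM xi) l <->
  len (@aact B^o) (colon K g `&` gZ (xi - nu)) (gZ (xi - nu)) l.
Proof.
move=> sK hK gg; symmetry.
have sKA := submodule_aact sK.
have sC : submodule (bact M) (msum K (cyc g)).
  by apply: submodule_msum => //; [exact: bactD | exact: submodule_cyc].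
apply: (@len_isom A B^o M (@aact B^o) (@aact M) (fun b => b *: g)).
- by move=> x y; apply: scalerBl.
- by move=> s x; rewrite /aact scalerA.
- exact: aactD.
- have gZmod := zgrading_graded gradedB; split.
  + by have [/(_ (xi - nu))[]] := dB.
  + by have [/(_ (xi - nu))[_ h] _ _] := dB; apply: h.
  + move=> a x gx; rewrite -[xi - nu]add0r; rewrite /aact.
    have [_ h] := gZmod; rewrite -zvec_of0; apply: h => //.
    by rewrite -zgradingE zvec_of0; exact: zgrading0_scalar.
- by apply: submoduleI => //; exact: submodule_gM.
- by apply: submoduleI; [exact: submodule_aact | exact: submodule_gM].
- by move=> x [Kx gx]; split=> //; apply: sub_msuml Kx; exact: submodule_cyc.
- by move=> x [].
- move=> x gx; split=> [[Kx _]|[Kx _]]; first by split.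
  by split=> //; rewrite -(subrK nu xi); apply: gM_scale.
- move=> x gx; split; last by rewrite -(subrK nu xi); apply: gM_scale.
  by apply: (sub_msumr sK); exists x.
(* For surjectivity, [b] is cut down to its component of degree [xi - nu]. The error is the
   component of [k] of degree [xi], which stays in [K] because [K] is homogeneous. *)
- move=> _ [[k [_ [Kk [b _ <-] ->]]] gy]; exists (hcomp dB (xi - nu) b); first exact: hcomp_in.
  have e := hcomp_id dM gy; rewrite hcompD (hcomp_scale _ _ gg) in e.
  have -> : k + b *: g - hcomp dB (xi - nu) b *: g = hcomp dM xi k.
    by rewrite -[X in X - _]e addrK.
  by split; [exact: hK | exact: hcomp_in].
Qed.

End Module.
End GradedModule.

(** * Hilbert series of quotients by homogeneous ideals *)

Section Coefficients.
Variable r : nat.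
Implicit Types (n : nvec r) (nu : zvec r).

Definition geom_coefz (k : nat) (z : int) : nat := if z is Posz m then geom_coef k m else 0%N.

Lemma geom_coefzS k z : geom_coefz k.+1 z = (geom_coefz k.+1 (z - 1) + geom_coefz k z)%N.
Proof.
case: z => [[|m]|m] //; first by rewrite /= big_ord_recr big_ord0.
have -> : m.+1%:Z - 1 = m%:Z by lia.
by rewrite /= big_ord_recr.
Qed.

Definition denom_coef n nu : nat := (\prod_(i < r) geom_coefz (n i) (nu i))%N.

Lemma inv_denomE n nu : inv_denom n nu = (denom_coef n nu)%:Z.
Proof. by rewrite /inv_denom /denom_coef (big_morph Posz PoszM (erefl _)); apply: eq_bigr => i _; case: (nu i). Qed.

Lemma add_nunitE n (i j : 'I_r) : (n + nunit i) j = (n j + (j == i))%N.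
Proof. by rewrite !ffunE. Qed.

(** The identity [(1 - t_i) / (1-t)^(n + e_i) = 1 / (1-t)^n] on coefficients, written additively to
    stay in [nat]. *)
Lemma denom_coefS n i nu : denom_coef (n + nunit i) nu =
  (denom_coef (n + nunit i)%R (nu - zvec_of (nunit i))%R + denom_coef n nu)%N.
Proof.
have e m mu : denom_coef m mu = (geom_coefz (m i) (mu i) *
    \prod_(j < r | j != i) geom_coefz (m j) (mu j))%N by rewrite /denom_coef (bigD1 i).
rewrite !e add_nunitE eqxx addn1 geom_coefzS mulnDl !ffunE eqxx.
congr (_ * _ + _ * _)%N; apply: eq_bigr => j /negPf ji.
  by rewrite add_nunitE !ffunE ji addn0 subr0.
by rewrite add_nunitE ji addn0.
Qed.

Lemma denom_coef_neg n (i : 'I_r) nu : nu i < 0 -> denom_coef n nu = 0%N.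
Proof. by move=> h; rewrite /denom_coef (bigD1 i) //=; case: (nu i) h. Qed.

Lemma denom_coef0 nu : denom_coef 0 nu = (nu == 0).
Proof.
rewrite /denom_coef; have [->|ne] := eqVneq nu 0.
  by rewrite big1 // => i _; rewrite !ffunE.
have [i ni] : exists i, nu i != 0.
  apply: contrapT => h; move/eqP: ne; apply; apply/ffunP => i; rewrite ffunE.
  by apply/eqP; apply: contrapT => /negP ni; apply: h; exists i.
by rewrite (bigD1 i) //= !ffunE; case: (nu i) ni => [[|m]|m].
Qed.

(* A pair [(a, n)] in [L] stands for the series [t^a / (1-t)^n]. *)
Definition list_coef (L : seq (zvec r * nvec r)) nu : nat :=
  (\sum_(p <- L) denom_coef p.2 (nu - p.1)%R)%N.

Lemma list_coef_cat L L' nu : list_coef (L ++ L') nu = (list_coef L nu + list_coef L' nu)%N.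
Proof. exact: big_cat. Qed.

Definition shift_list (a : zvec r) (L : seq (zvec r * nvec r)) := [seq (p.1 + a, p.2) | p <- L].

Lemma list_coef_shift a L nu : list_coef (shift_list a L) nu = list_coef L (nu - a).
Proof.
by rewrite /list_coef big_map; apply: eq_bigr => p _ /=; rewrite opprD addrA addrAC.
Qed.

(** Division of the series by [1 - t_i]. *)
Definition raise_list i (L : seq (zvec r * nvec r)) := [seq (p.1, p.2 + nunit i) | p <- L].

Lemma list_coef_raise i L nu : list_coef (raise_list i L) nu =
  (list_coef (raise_list i L) (nu - zvec_of (nunit i))%R + list_coef L nu)%N.
Proof.
rewrite /list_coef !big_map -big_split; apply: eq_bigr => p _ /=.
by rewrite denom_coefS addrAC.
Qed.

Lemma list_coef_neg L i :
  exists N : nat, forall nu : zvec r, nu i < - N%:Z -> list_coef L nu = 0%N.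
Proof.
exists (\sum_(p <- L) `|p.1 i|)%N => nu nuN; rewrite /list_coef big1_seq // => p /= pL.
apply: (@denom_coef_neg _ i); rewrite !ffunE; move: nuN.
by rewrite (big_rem p) //=; lia.
Qed.

Lemma absdegD n n' : absdeg (n + n') = (absdeg n + absdeg n')%N.
Proof. by rewrite /absdeg -big_split; apply: eq_bigr => i _; rewrite !ffunE. Qed.

Lemma absdeg_nunit i : absdeg (nunit i : nvec r) = 1%N.
Proof.
rewrite /absdeg (bigD1 i) //= big1 ?ffunE ?eqxx ?addn0 // => j /negPf ji.
by rewrite ffunE ji.
Qed.

End Coefficients.

Section HilbertSeries.
Variables (r : nat) (A : comNzRingType) (B : comAlgType A) (gB : nvec r -> set B).
Hypothesis gradedB : graded_algebra gB.

Local Notation gZ := (zgrading gB).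
Local Notation gradedZ := (zgrading_graded gradedB).
Local Notation dB := (graded_direct gradedZ).
Local Notation homogB := (homog gradedZ).
Local Notation primes_over I := [set p : set B | is_prime_ideal p /\ I `<=` p].

Definition homog_prime (I : set B) := forall nu mu a b,
  gZ nu a -> gZ mu b -> I (a * b) -> I a \/ I b.

(** For [a], [b] outside [I], let [al], [be] be the lexicographically largest degrees of components
    outside [I]. In the component of [a * b] of degree [al + be], every product but the leading one
    has a factor of larger degree, hence in [I]. So the leading product is in [I], against primality
    on homogeneous elements. *)
Lemma homog_prime_is_prime I : ideal I -> homogB I -> ~ I 1 -> homog_prime I ->
  is_prime_ideal I.
Proof.
move=> sI hI n1 hp; split; [exact/is_idealP | exact: n1 | move=> a b Iab].
apply: contrapT => /not_orP[nIa nIb].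
have lead (c : B) : ~ I c -> exists2 nu, ~ I (hcomp dB nu c) &
    forall mu, lex nu mu -> I (hcomp dB mu c).
  move=> nIc; have [s [us s0 cE]] := hcomp_sum dB c.
  have [|nu nInu numax] := @lex_max _ s (fun nu => ~ I (hcomp dB nu c)).
    apply: contrapT => h; apply: nIc; rewrite cE.
    apply: (submodule_sum sI) => nu nus; apply: contrapT => nIn.
    by apply: h; exists nu.
  exists nu => // mu lt; have [ins|/s0 ->] := boolP (mu \in s); last exact: submodule0 sI.
  by apply: contrapT => nI; apply: (numax mu).
have [al nIal alM] := lead a nIa; have [be nIbe beM] := lead b nIb.
suff : I (hcomp dB al a * hcomp dB be b).
  by move=> /(hp al be _ _ (hcomp_in dB _ _) (hcomp_in dB _ _)) [].
have Ic := hI (al + be) (a * b) Iab.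
have [s [us s0 aE]] := hcomp_sum dB a.
have als : al \in s.
  by apply: contrapT => /negP /s0 e; apply: nIal; rewrite e; exact: submodule0 sI.
have e : hcomp dB (al + be) (a * b) = \sum_(mu <- s) hcomp dB mu a * hcomp dB (al + be - mu) b.
  rewrite {1}aE mulr_suml hcomp_bigsum; apply: eq_bigr => mu _.
  exact: (hcomp_scale_hom gradedZ (al + be) b (hcomp_in dB mu a)).
rewrite e (bigD1_seq al) //= addrAC subrr add0r in Ic.
rewrite -[X in I X](addrK (\sum_(mu <- s | mu != al) hcomp dB mu a * hcomp dB (al + be - mu) b)).
apply: (submoduleB sI) => //; rewrite -big_filter; apply: (submodule_sum sI) => mu.
rewrite mem_filter => /andP[/eqP ne mus].
case: (lex_total ne) => lt; last first.
  by rewrite mulrC; apply: (submodule_act _ sI); exact: alM.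
apply: (submodule_act _ sI); apply: beM.
have := lex_add (be - mu) lt; rewrite addrC subrK.
by rewrite [al + _]addrA.
Qed.

Hypothesis noeB : noetherian B.
Hypothesis artA : artinian_ring A.
Variables (k : nat) (x : 'I_k -> B).
Hypothesis degx : forall j, exists i : 'I_r, gB (nunit i) (x j).
Hypothesis genx : forall S : set B, is_subalgebra S -> (forall j, S (x j)) -> S = setT.
Hypothesis gB0 : gB 0 = range (fun a : A => a%:A : B).

Definition hilbert_list (I : set B) L :=
  (forall nu, len (@aact A B B^o) (I `&` gZ nu) (gZ nu) (list_coef L nu)) /\
  (forall p, p \in L -> has_chain (primes_over I) (absdeg p.2)).

Let ideal_bact (I : set B) : ideal I -> submodule (fun (b : B) (m : B^o) => b *: m) I.
Proof. by []. Qed.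

Let colonE (I : set B) (a y : B) : colon (M := B^o) I a y = I (y * a).
Proof. by []. Qed.

Let sub_gZ nu : submodule (@aact A B B^o) (gZ nu).
Proof. exact: (submodule_gM gradedB gradedZ). Qed.

Let sub_IgZ I nu : ideal I -> submodule (@aact A B B^o) (I `&` gZ nu).
Proof. by move=> sI; apply: submoduleI => //; apply: submodule_aact; exact: ideal_bact. Qed.

Let add_cyc I (sI : ideal I) (a : B) : ideal (msum I (cyc (M := B^o) a)).
Proof.
apply: submodule_msum => //; first by move=> s y z; exact: mulrDr.
exact: (submodule_cyc (M := B^o)).
Qed.

Let sub_add_cyc I (a : B) : I `<=` msum I (cyc (M := B^o) a).
Proof. by apply: sub_msuml; exact: (submodule_cyc (M := B^o)). Qed.

Let in_add_cyc I (a : B) : ideal I -> msum I (cyc (M := B^o) a) a.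
Proof. by move=> sI; apply: (sub_msumr sI); exists 1 => //; rewrite scale1r. Qed.

Lemma len_colon_cyc I (sI : ideal I) (hI : homogB I) mu (a : B) nu l l' : gZ mu a ->
  len (@aact A B B^o) (colon (M := B^o) I a `&` gZ (nu - mu)) (gZ (nu - mu)) l ->
  len (@aact A B B^o) (msum I (cyc (M := B^o) a) `&` gZ nu) (gZ nu) l' ->
  len (@aact A B B^o) (I `&` gZ nu) (gZ nu) (l + l').
Proof.
move=> ga lc ls; apply: len_add ls => //; first exact: aactD.
- by apply: sub_IgZ; exact: add_cyc.
- by move=> y [Iy gy]; split=> //; exact: sub_add_cyc.
- by apply/(len_cyc gradedB nu l (ideal_bact sI) hI ga).
Qed.

Lemma hilbert_list_ex (I : {I : set B | ideal I}) : homogB (sval I) ->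
  exists L, hilbert_list (sval I) L.
Proof.
elim: I / (noetherian_wf noeB I) => -[I sI] _ /= IH hI.
have {}IH J : ideal J -> homogB J -> I `<=` J -> ~ J `<=` I -> exists L, hilbert_list J L.
  by move=> sJ hJ IJ JI; apply: (IH (exist _ J sJ)).
have sub_chain J l : I `<=` J -> has_chain (primes_over J) l -> has_chain (primes_over I) l.
  by move=> IJ; apply: has_chain_sub => p [pp Jp]; split=> //; exact: subset_trans Jp.
have [I1|nI1] := pselect (I 1).
  exists [::]; split=> // nu; rewrite /list_coef big_nil.
  have -> : I `&` gZ nu = gZ nu.
    apply/seteqP; split=> [y []//|y gy]; split=> //.
    by rewrite -[y]mulr1; exact: (submodule_act y sI).
  exact: len_refl.
have [hp|nhp] := pselect (homog_prime I); last first.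
  have [nu [mu [a [b [ga gb Iab nIa nIb]]]]] : exists nu mu a b,
      [/\ gZ nu a, gZ mu b, I (a * b), ~ I a & ~ I b].
    apply: contrapT => h; apply: nhp => nu mu a b ga gb Iab.
    by apply: contrapT => /not_orP[nIa nIb]; apply: h; exists nu, mu, a, b.
  have sC := ideal_colon a (ideal_bact sI).
  have [||//|//|L1 [l1 c1]] := IH (colon (M := B^o) I a).
  - exact: sC.
  - exact: (homog_colon gradedB hI ga).
  - by move=> y Iy; rewrite colonE mulrC; apply: (submodule_act a sI).
  - by move=> h; apply: nIb; apply: h; rewrite colonE mulrC.
  have [||//|//|L2 [l2 c2]] := IH (msum I (cyc (M := B^o) a)).
  - exact: add_cyc.
  - exact: (homog_msum gradedB (ideal_bact sI) hI ga).
  - by move=> h; apply: nIa; apply: h; exact: in_add_cyc.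
  exists (shift_list nu L1 ++ L2); split.
    move=> xi; rewrite list_coef_cat list_coef_shift; exact: (len_colon_cyc sI hI ga).
  move=> p; rewrite mem_cat => /orP[/mapP[q qL ->]|pL].
    by apply: sub_chain (c1 _ qL) => y Iy; rewrite colonE mulrC; apply: (submodule_act a sI).
  by apply: sub_chain (c2 _ pL); exact: sub_add_cyc.
have pI := homog_prime_is_prime sI hI nI1 hp.
have [[j nIx]|allx] := pselect (exists j, ~ I (x j)).
  have [i gx] := degx j.
  have gxZ : gZ (zvec_of (nunit i)) (x j) by rewrite zgradingE.
  have [||//|//|L [lL cL]] := IH (msum I (cyc (M := B^o) (x j))).
  - exact: add_cyc.
  - exact: (homog_msum gradedB (ideal_bact sI) hI gxZ).
  - by move=> h; apply: nIx; apply: h; exact: in_add_cyc.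
  (* As [I] is prime and misses [x j], multiplication by [x j] is injective on [B / I]. *)
  have colonI : colon (M := B^o) I (x j) = I.
    apply/seteqP; split=> y; rewrite colonE.
      by have [_ _ h] := pI => /h[].
    by move=> Iy; rewrite mulrC; apply: (submodule_act _ sI).
  exists (raise_list i L); split; last first.
    move=> p /mapP[q qL ->] /=; rewrite absdegD absdeg_nunit.
    have [C [PC CC]] := cL q qL.
    (* The one-step chain from [I] to [C 0] is glued to [C]; it is strict because [x j] lies in
       [C 0] but not in [I]. *)
    rewrite addnC; apply: (@chain_cat _ _ (fun m => if m is 0%N then I else C 0%N) C 1).
    - split=> [[|m] mle|[|m] mle] //.
      + by split.
      + by have [pp Jp] := PC 0%N isT; split=> //; apply: subset_trans Jp; exact: sub_add_cyc.
      + have [_ Jp] := PC 0%N isT; split; first by apply: subset_trans Jp; exact: sub_add_cyc.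
        by move=> h; apply: nIx; apply: h; apply: Jp; exact: in_add_cyc.
    - split=> // m ml; have [pp Jp] := PC m ml; split=> //.
      by apply: subset_trans Jp; exact: sub_add_cyc.
    - by [].
  (* The exact sequence now computes degree [nu] of [B / I] from degree [nu - e_i] of the same ring,
     which calls for an inner induction on the [i]-th entry. It starts below [- N], where the
     coefficient and the graded piece both vanish. *)
  have [N NP] := list_coef_neg (raise_list i L) i.
  suff h (m : nat) (nu : zvec r) : nu i < m%:Z - N%:Z ->
      len (@aact A B B^o) (I `&` gZ nu) (gZ nu) (list_coef (raise_list i L) nu).
    by move=> nu; apply: (h (`|nu i| + N).+1); lia.
  elim: m nu => [|m IHm] nu nuN.
    rewrite NP; last by lia.
    have -> : I `&` gZ nu = gZ nu.
      apply/seteqP; split=> [y []//|y gy]; split=> //.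
      have -> : y = 0 by apply: (zgrading_neg (i := i) _ gy); lia.
      exact: submodule0 sI.
    exact: len_refl.
  rewrite list_coef_raise; apply: (len_colon_cyc sI hI gxZ) => //.
  rewrite colonI; apply: IHm; rewrite !ffunE eqxx /=; lia.
(* With all generators in [I], [B] is [A + I]. Thus [B / I] is [A / K] placed in degree 0, and [l0]
   copies of the constant series 1 describe it. *)
have allI b : exists a : A, I (b - a%:A).
  suff -> : (exists a : A, I (b - a%:A)) = [set: B] b by [].
  rewrite -(genx (S := [set b | exists a : A, I (b - a%:A)])) //; last first.
    move=> j; exists 0; rewrite scale0r subr0; apply: contrapT => nIx.
    by apply: allx; exists j.
  split.
  - by move=> a; exists a; rewrite subrr; exact: submodule0 sI.
  - move=> y z [a Ia] [c Ic]; exists (a + c).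
    by rewrite scalerDl opprD addrACA; exact: submoduleD sI _ _.
  - move=> y z [a Ia] [c Ic]; exists (a * c).
    have -> : y * z - (a * c)%:A = z * (y - a%:A) + a%:A * (z - c%:A).
      by rewrite -in_algE rmorphM /=; ring.
    by apply: (submoduleD sI); exact: (submodule_act _ sI).
have [l lA] := artinian_fin_len artA.
pose K : set A := [set a | I a%:A].
have sK : ideal K by exact: (ideal_preimage (in_alg B) sI).
have [l0 l0E] : exists l0, len *%R K setT l0.
  by apply: fin_len_sub lA => // _ ->; exact: submodule0 sK.
exists (nseq l0 (0, 0)); split; last first.
  move=> p /nseqP[-> _] /=; have -> : absdeg (0 : nvec r) = 0%N.
    by rewrite /absdeg big1 // => i _; rewrite ffunE.
  by apply: (@has_chain0 _ _ I); split.
move=> nu; have -> : list_coef (nseq l0 (0, 0)) nu = (l0 * (nu == 0%R))%N.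
  by rewrite /list_coef big_nseq iter_addn addn0 /= subr0 denom_coef0 mulnC.
have [->|ne] := eqVneq nu 0; last first.
  rewrite muln0; have -> : I `&` gZ nu = gZ nu; last exact: len_refl.
  apply/seteqP; split=> [y []//|y gy]; split=> //.
  have [a Ia] := allI y; have := hI nu _ Ia.
  rewrite hcompB (hcomp_id _ gy) (hcomp_hom dB _ (zgrading0_scalar gradedB a)).
  by rewrite (negPf ne) subr0.
rewrite muln1.
apply/(@len_isom A A B^o *%R (@aact A B B^o) (fun a : A => a%:A : B) K setT) => //.
- exact: (rmorphB (in_alg B)).
- exact: (rmorphM (in_alg B)).
- exact: aactD.
- exact: sub_IgZ.
- by move=> y _; split=> [[]//|Iy]; split=> //; exact: zgrading0_scalar.
- by move=> y _; exact: zgrading0_scalar.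
- move=> y gy; have : gB 0 y by rewrite -zgradingE zvec_of0.
  rewrite gB0 => -[a _ <-]; exists a => //; rewrite subrr; exact: (submodule0 (sub_IgZ 0 sI)).
Qed.

End HilbertSeries.

(** * Growth along chains of primes *)

Section PrimeChains.
Variables (S : Type) (R : comNzRingType) (act : S -> R -> R).
Hypothesis actD : forall s, {morph act s : x y / x + y}.
Hypothesis actM : forall s x y, act s (x * y) = x * act s y.
Variable F : nat -> set R.
Hypothesis sF : forall s, submodule act (F s).
Hypothesis F_mono : forall s t, (s <= t)%N -> F s `<=` F t.
Hypothesis F_mul : forall s t x y, F s x -> F t y -> F (s + t)%N (x * y).
Hypothesis F_cover : forall x, exists s, F s x.

Lemma ideal_submodule (I : set R) : ideal I -> submodule act I.
Proof.
move=> sI; split; [exact: submodule0 sI | by move=> x y; exact: submoduleB sI | ].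
by move=> s x Ix; rewrite -[x]mulr1 actM mulrC; exact: (submodule_act _ sI).
Qed.

(* Multiplication by [f] embeds [R/p] into [q/p]. *)
Lemma chain_prime_step (p q : set R) f c s n m :
  is_prime_ideal p -> ideal q -> p `<=` q -> q f -> ~ p f -> F c f ->
  has_chain (between act p (msum p (F s))) n ->
  has_chain (between act q (msum q (F (s + c)%N))) m ->
  has_chain (between act p (msum p (F (s + c)%N))) (n + m).
Proof.
move=> [/is_idealP sp _ pp] sq pq qf npf Fcf.
have spA := ideal_submodule sp; have sqA := ideal_submodule sq.
(* The interval is cut at [E]. Below it, the first chain is multiplied by [f]. Above it, since [p]
   is inside [q], the quotient [(p + F) / E] is [(q + F) / q], from which the second chain is pulled
   back. *)
pose E := msum p (q `&` F (s + c)%N).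
have sqF : submodule act (q `&` F (s + c)%N) by exact: submoduleI.
have sE : submodule act E by exact: submodule_msum.
have pE : p `<=` E by exact: (sub_msuml sqF).
have EN : E `<=` msum p (F (s + c)%N).
  apply: (msum_sub (submodule_msum actD spA (sF _))); first exact: (sub_msuml (sF _)).
  by move=> x [_ Fx]; exact: (sub_msumr spA).
move=> cn cm; apply: (has_chain_between pE EN).
  apply: (@has_chain_map _ _ _ _ (fun X => msum p [set f * x | x in X])) cn.
  - move=> X [sX pX XF].
    have sfX : submodule act [set f * x | x in X].
      split; first by exists 0; [exact: submodule0 sX | rewrite mulr0].
        move=> _ _ [x Xx <-] [y Xy <-]; exists (x - y); first exact: submoduleB sX _ _.
        by rewrite mulrBr.
      by move=> t _ [x Xx <-]; exists (act t x); [exact: (submodule_act _ sX) | rewrite actM].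
    split; [exact: submodule_msum | exact: (sub_msuml sfX) |].
    apply: (msum_sub sE pE) => _ [x /XF [a [y [pa Fy ->]]] <-].
    exists (f * a), (f * y); rewrite mulrDr; split=> //.
      exact: (submodule_act _ sp).
    split; first by rewrite mulrC; exact: (submodule_act _ sq).
    by rewrite addnC; exact: F_mul.
  - move=> X Y _ _ XY; move=> _ [k [_ [pk [x Xx <-] ->]]].
    by exists k, (f * x); split=> //; exists x => //; exact: XY.
  - move=> X Y [sX pX _] [sY pY _] XY sub x Yx.
    have [|k [_ [pk [x' Xx' <-] e]]] := sub (f * x).
      by apply: (sub_msumr spA); exists x.
    rewrite -(subrK x' x); apply: (submoduleD sX) => //; apply: pX.
    by case: (pp f (x - x')); rewrite // mulrBr e addrK.
apply: (@has_chain_map _ _ _ _ (fun X => msum p (X `&` F (s + c)%N))) cm.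
- move=> X [sX qX XF]; have sXF : submodule act (X `&` F (s + c)%N) by exact: submoduleI.
  split; first exact: submodule_msum.
    by move=> _ [k [x [pk [qx Fx] ->]]]; exists k, x; split=> //; split=> //; exact: qX.
  by move=> _ [k [x [pk [Xx Fx] ->]]]; exists k, x.
- move=> X Y _ _ XY _ [k [x [pk [Xx Fx] ->]]].
  by exists k, x; split=> //; split=> //; exact: XY.
- move=> X Y [sX qX XF] [sY qY YF] XY sub x Yx.
  have [a [y [qa Fy xE]]] := YF x Yx.
  have Yy : Y y.
    have -> : y = x - a by rewrite xE addrC addKr.
    by apply: (submoduleB sY) => //; exact: qY.
  have [|k [z [pk [Xz _] yE]]] := sub y.
    by apply: (sub_msumr spA); split.
  rewrite xE yE; apply: (submoduleD sX); first exact: qX.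
  by apply: (submoduleD sX) => //; apply/qX/pq.
Qed.

Lemma prime_chain_growth (C : nat -> set R) l :
  (forall i, (i <= l)%N -> is_prime_ideal (C i)) ->
  (forall i, (i < l)%N -> C i `<` C i.+1) ->
  exists c, forall u, (0 < u)%N ->
    has_chain (between act (C 0%N) (msum (C 0%N) (F (c * u)%N))) (u ^ l).
Proof.
elim: l C => [|l IH] C PC CC.
  have [c Fc1] := F_cover 1; exists c => u u0.
  have [/is_idealP sp p1 _] := PC 0%N isT; have spA := ideal_submodule sp.
  exists (fun i => if i is 0%N then C 0%N else msum (C 0%N) (F (c * u)%N)); split.
    move=> [|i] _; split=> //; try exact: (sub_msuml (sF _)).
    exact: submodule_msum.
  move=> [|i] // _; split; first exact: (sub_msuml (sF _)).
  move=> sub; apply: p1; apply: sub; apply: (sub_msumr spA).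
  by apply: F_mono Fc1; rewrite leq_pmulr.
have [i il|i il|c cP] := IH (fun i => C i.+1); [exact: PC | exact: CC |].
have [sub] := CC 0%N isT => /existsNP[f /not_implyP[qf npf]].
have [c' Ff] := F_cover f; exists (c + c')%N => u u0.
have [/is_idealP sq _ _] := PC 1%N isT.
have [/is_idealP sp _ _] := PC 0%N isT; have spA := ideal_submodule sp.
(* With [c'] a level of the filtration containing [f], each multiplication by [f] costs [c'] in the
   filtration and adds a layer with [u ^ l] steps coming from the next prime. Taking [t = u] yields
   [u ^ l.+1] steps at level [(c + c') * u]. *)
suff h t : has_chain (between act (C 0%N) (msum (C 0%N) (F (c * u + t * c')%N))) (t * u ^ l).
  by have := h u; rewrite expnS mulnDl [(u * c')%N]mulnC.
elim: t => [|t IHt].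
  by apply: (@has_chain0 _ _ (C 0%N)); split=> //; exact: (sub_msuml (sF _)).
rewrite !mulSnr addnA; apply: (chain_prime_step (q := C 1%N) _ _ _ qf npf Ff) => //.
  exact: PC.
apply: has_chain_sub (cP u u0) => X [sX qX XF]; split=> //.
apply: subset_trans XF _; move=> _ [k [x [qk Fx ->]]]; exists k, x; split=> //.
by apply: F_mono Fx; lia.
Qed.

End PrimeChains.

(** * Polynomial bounds for sums of coefficients over boxes *)

Lemma sum_geom_coef m X : (\sum_(j < X) geom_coef m j <= X ^ m)%N.
Proof.
elim: m X => [|m IHm] X.
  case: X => [|X]; first by rewrite big_ord0.
  by rewrite big_ord_recl big1.
rewrite expnS -[X in (_ <= X * _)%N]card_ord -sum_nat_const; apply: leq_sum => j _ /=.
by apply: leq_trans (IHm _) _; case: m {IHm} => // m; rewrite leq_exp2r.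
Qed.

Lemma sum_geom_coefz m (c : int) K X : K%:Z - c <= X%:Z ->
  (\sum_(k < K) geom_coefz m (k%:Z - c) <= X ^ m)%N.
Proof.
move=> le; apply: leq_trans (sum_geom_coef m X).
elim: K X le => [|K IHK] X le; first by rewrite big_ord0.
rewrite big_ord_recr /=; case e: (K%:Z - c) => [j|j] /=.
  have jX : (j < X)%N by lia.
  apply: (@leq_trans (\sum_(i < j.+1) geom_coef m i)%N).
    by rewrite big_ord_recr /= leq_add2r IHK // e.
  rewrite -(subnKC jX) big_split_ord /=; exact: leq_addr.
by rewrite addn0 IHK //; lia.
Qed.

Section Box.
Variable r : nat.

Definition in_box (s : nat) (nu : zvec r) := forall i, (`|nu i| <= s)%N.

(** Shifting by [s] presents the box as the image of a finite function type, so that a sum of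
    products over it factors into a product of one-variable sums. *)
Definition box (s : nat) : seq (zvec r) :=
  [seq [ffun i => (f i : nat)%:Z - s%:Z] | f : {ffun 'I_r -> 'I_(s + s).+1}].

Lemma box_uniq s : uniq (box s).
Proof.
rewrite map_inj_uniq ?enum_uniq // => f g /ffunP e; apply/ffunP => i.
by apply/val_inj; have := e i; rewrite !ffunE => /addIr [].
Qed.

Lemma in_boxP s nu : in_box s nu -> nu \in box s.
Proof.
move=> bn; apply/mapP; exists [ffun i => inord `|(nu i + s%:Z)%R|%N]; rewrite ?mem_enum //.
apply/ffunP => i; have bi := bn i; rewrite !ffunE inordK; last by lia.
by rewrite gez0_abs ?addrK //; lia.
Qed.

Lemma sum_box_denom_coef s N (n : nvec r) (a : zvec r) : (forall i, (`|a i| <= N)%N) ->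
  (\sum_(nu <- box s) denom_coef n (nu - a)%R <= (s + N).+1 ^ absdeg n)%N.
Proof.
move=> aN; rewrite big_map big_enum /=.
have -> : (\sum_(f : {ffun 'I_r -> 'I_(s + s).+1})
    denom_coef n ([ffun i => (f i : nat)%:Z - s%:Z] - a)%R =
  \prod_(i < r) \sum_(k < (s + s).+1) geom_coefz (n i) ((k : nat)%:Z - (s%:Z + a i))%R)%N.
  rewrite bigA_distr_bigA; apply: eq_bigr => f _; apply: eq_bigr => i _.
  by rewrite !ffunE opprD addrA.
rewrite /absdeg expn_sum; apply: leq_prod => i _; apply: sum_geom_coefz.
by have := aN i; lia.
Qed.

(** The natural bound is [size L * (s + N).+1 ^ (d - 1)]; it is multiplied through by [(s + N).+1]
    to avoid the exponent [d - 1]. The number [N] dominates every entry of every shift in [L]. *)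
Lemma sum_box_list_coef (L : seq (zvec r * nvec r)) d :
  (forall p, p \in L -> (absdeg p.2 < d)%N) ->
  exists N, forall s, ((\sum_(nu <- box s) list_coef L nu) * (s + N).+1
                        <= size L * (s + N).+1 ^ d)%N.
Proof.
move=> Ld; pose N := (\sum_(p <- L) \sum_(i < r) `|p.1 i|)%N; exists N => s.
rewrite exchange_big big_distrl -sum1_size big_distrl /= !big_seq; apply: leq_sum => p pL.
rewrite mul1n -(subnK (Ld p pL)) addnS expnSr leq_mul2r /= expnD.
have aN i : (`|p.1 i| <= N)%N.
  by rewrite /N (big_rem p) //= (bigD1 i) //= -addnA leq_addr.
apply: leq_trans (sum_box_denom_coef s p.2 aN) _.
by rewrite leq_pmull // expn_gt0.
Qed.

End Box.

(** * Finitely generated graded modules *)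

Section GradedModuleHilbert.
Variables (r : nat) (A : comNzRingType) (B : comAlgType A) (gB : nvec r -> set B).
Hypothesis gradedB : graded_algebra gB.
Variables (M : lmodType B) (gM : zvec r -> set M).
Hypothesis gradedM : graded_module gB gM.

Local Notation bact := (fun (b : B) (m : M) => b *: m).
Local Notation gZ := (zgrading gB).
Local Notation gradedZ := (zgrading_graded gradedB).
Local Notation dB := (graded_direct gradedZ).
Local Notation dM := (graded_direct gradedM).
Local Notation primes_over I := [set p : set B | is_prime_ideal p /\ I `<=` p].

Fixpoint gspan (gs : seq (zvec r * M)) : set M :=
  if gs is g :: gs' then msum (gspan gs') (cyc g.2) else [set 0].

Lemma submodule_gspan gs : submodule bact (gspan gs).
Proof.
elim: gs => [|g gs IH] /=.
  by split=> // [x y -> ->|s x ->] /=; rewrite ?subrr ?scaler0.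
by apply: submodule_msum => //; [exact: bactD | exact: submodule_cyc].
Qed.

Definition homogeneous (gs : seq (zvec r * M)) := forall g, g \in gs -> gM g.1 g.2.

Lemma homogeneous_cons g gs : homogeneous (g :: gs) -> gM g.1 g.2 /\ homogeneous gs.
Proof.
by move=> h; split=> [|g' g's]; apply: h; rewrite inE ?eqxx // g's orbT.
Qed.

Lemma homog_gspan gs : homogeneous gs -> homog gradedM (gspan gs).
Proof.
elim: gs => [_|g gs IH /homogeneous_cons[gg /IH hgs]] /=.
  by move=> nu _ ->; rewrite hcomp0.
exact: (homog_msum gradedB (submodule_gspan gs) hgs gg).
Qed.

Lemma mem_gspan gs g : g \in gs -> gspan gs g.2.
Proof.
elim: gs => // g' gs IH; rewrite inE => /predU1P[->|/IH h] /=.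
  by apply: (sub_msumr (submodule_gspan gs)); exists 1; rewrite ?scale1r.
exact: (sub_msuml (submodule_cyc g'.2)).
Qed.

Lemma homogeneous_generators : fin_gen_module M ->
  exists2 gs, homogeneous gs & gspan gs = setT.
Proof.
move=> [k [g gen]].
have [s sP] := choice (fun j => hcomp_sum dM (g j)).
pose gs := flatten [seq [seq (nu, hcomp dM nu (g j)) | nu <- s j] | j : 'I_k].
have gsP j nu : nu \in s j -> (nu, hcomp dM nu (g j)) \in gs.
  move=> nus; apply/flatten_mapP; exists j; rewrite ?mem_enum //.
  by apply/mapP; exists nu.
exists gs.
  by move=> _ /flatten_mapP[j _ /mapP[nu _ ->]]; exact: hcomp_in.
apply/seteqP; split=> // m _; have [c ->] := gen m.
have sG := submodule_gspan gs.
apply: (submodule_sum sG) => j _; apply: (submodule_act (c j) sG).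
have [_ _ ->] := sP j; apply: (submodule_sum sG) => nu /gsP.
exact: mem_gspan.
Qed.

Hypothesis hilbert_list_exists : forall I, ideal I -> homog gradedZ I ->
  exists L, hilbert_list gB I L.

(** The filtration by successive generators has quotients [B / (gspan gs : g)], shifted. Each of
    these colon ideals contains the annihilator of [M], so the prime chains obtained lie over that
    annihilator. *)
Lemma hilbert_list_gspan gs : homogeneous gs -> exists L,
  (forall nu, len (@aact A B M) [set 0] (gspan gs `&` gM nu) (list_coef L nu)) /\
  (forall p, p \in L -> has_chain (primes_over (annihilator M)) (absdeg p.2)).
Proof.
have s0 : submodule (@aact A B M) [set 0].
  by split=> // [x y -> ->|s x ->] /=; rewrite /aact ?subrr ?scaler0.
have sub0 (N : set M) : submodule (@aact A B M) N -> [set 0] `<=` N.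
  by move=> sN _ ->; exact: submodule0 sN.
elim: gs => [|g gs IH] hgs.
  exists [::]; split=> // nu; rewrite /list_coef big_nil /=.
  have -> : [set 0] `&` gM nu = [set 0].
    by apply/seteqP; split=> [x []//|x x0]; split=> //; rewrite x0; exact: (gM0 gradedM).
  exact: len_refl.
have [gg hgs'] := homogeneous_cons hgs; have [L [lL cL]] := IH hgs'.
have sG := submodule_gspan gs; have hG := homog_gspan hgs'.
have [||L' [lL' cL']] := hilbert_list_exists (I := colon (gspan gs) g.2).
- exact: ideal_colon.
- exact: (homog_colon gradedB hG gg).
exists (L ++ shift_list g.1 L'); split=> [nu|p].
  rewrite list_coef_cat list_coef_shift.
  have sub gs' : submodule (@aact A B M) (gspan gs' `&` gM nu).
    apply: submoduleI; last exact: (submodule_gM gradedB gradedM).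
    exact: submodule_aact (submodule_gspan gs').
  apply: (len_add (@aactD A B M) (sub gs) (sub (g :: gs)) (sub0 _ (sub gs)) _ (lL nu)).
  - by move=> x [Gx gx]; split=> //; apply: sub_msuml Gx; exact: submodule_cyc.
  - by apply/(len_cyc gradedB nu _ sG hG gg).
rewrite mem_cat => /orP[/cL //|/mapP[q qL ->] /=].
apply: has_chain_sub (cL' q qL) => P [pP sP]; split=> //.
by move=> b bM; apply: sP; rewrite /colon /= bM; exact: submodule0 sG.
Qed.

(** A filtration by [A]-submodules; applied to [B] itself it is multiplicative, as the growth
    argument requires. *)
Definition boxed (s : nat) : set M :=
  [set m | forall nu, ~ in_box s nu -> hcomp dM nu m = 0].

Lemma in_box_mono s t nu : (s <= t)%N -> in_box s nu -> @in_box r t nu.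
Proof. by move=> st bs i; apply: leq_trans st. Qed.

Lemma in_boxD s t nu mu : in_box s nu -> in_box t mu -> @in_box r (s + t)%N (nu + mu).
Proof. by move=> bs bt i; rewrite ffunE; move: (nu i) (mu i) (bs i) (bt i) => a b; lia. Qed.

Lemma boxed_mono s t : (s <= t)%N -> boxed s `<=` boxed t.
Proof. by move=> st m ms nu nt; apply: ms => ns; apply: nt; exact: in_box_mono ns. Qed.

Lemma boxed_cover m : exists s, boxed s m.
Proof.
have [t [_ t0 _]] := hcomp_sum dM m.
exists (\sum_(nu <- t) \sum_(i < r) `|nu i|)%N => nu nbox.
have [nut|/t0 //] := boolP (nu \in t); exfalso; apply: nbox => i.
by rewrite (big_rem nu) //= (bigD1 i) //= -addnA leq_addr.
Qed.

Lemma submodule_boxed s : submodule (@aact A B M) (boxed s).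
Proof.
split=> [nu _|x y bx bY nu nb|a x bx nu nb]; first exact: hcomp0.
  by rewrite hcompB bx ?bY ?subrr.
rewrite /aact (hcomp_scale_hom gradedM nu x (zgrading0_scalar gradedB a)).
by rewrite subr0 bx ?scaler0.
Qed.

Lemma len_components (H : zvec r -> nat) (t : seq (zvec r)) : uniq t ->
  (forall nu, len (@aact A B M) [set 0] (gM nu) (H nu)) ->
  len (@aact A B M) [set 0] [set m | forall nu, nu \notin t -> hcomp dM nu m = 0]
    (\sum_(nu <- t) H nu).
Proof.
move=> + lH; pose W (t : seq (zvec r)) := [set m | forall nu, nu \notin t -> hcomp dM nu m = 0].
have sW u : submodule (@aact A B M) (W u).
  split=> [nu _|x y bx bY nu nb|a x bx nu nb]; first exact: hcomp0.
    by rewrite hcompB bx ?bY ?subrr.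
  rewrite /aact (hcomp_scale_hom gradedM nu x (zgrading0_scalar gradedB a)).
  by rewrite subr0 bx ?scaler0.
elim: t => [_|nu t IH /= /andP[nut ut]].
  rewrite big_nil -/(W [::]); have -> : W [::] = [set 0].
    apply/seteqP; split=> [m /= m0|_ -> nu _]; last exact: hcomp0.
    by have [s [_ _ ->]] := hcomp_sum dM m; rewrite big1 // => nu _; exact: m0.
  by apply: len_refl; split=> // [x y -> ->|s x ->] /=; rewrite /aact ?subrr ?scaler0.
have WW : W t `<=` W (nu :: t).
  by move=> m mt mu; rewrite inE negb_or => /andP[_ /mt].
have sub0 : [set 0] `<=` W t by move=> _ ->; exact: submodule0 (sW t).
rewrite big_cons addnC.
apply: (len_add (@aactD A B M) (sW t) (sW (nu :: t)) sub0 WW (IH ut)).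
(* The inclusion of [gM nu] induces an isomorphism onto [W (nu :: t) / W t]. *)
have isom : len (@aact A B M) [set 0] (gM nu) (H nu) <->
    len (@aact A B M) (W t) (W (nu :: t)) (H nu); last exact/isom.
apply: (@len_isom A M M _ _ id) => //.
- exact: aactD.
- exact: (submodule_gM gradedB gradedM).
- by move=> _ ->; exact: (gM0 gradedM).
- move=> x gx; split=> [Wx|->]; last exact: submodule0 (sW t).
  by rewrite -(hcomp_id dM gx); exact: Wx.
- move=> x gx mu; rewrite inE negb_or (hcomp_hom dM mu gx) => /andP[/negPf -> //].
- move=> y Wy; exists (hcomp dM nu y); first exact: hcomp_in.
  move=> mu mut; rewrite hcompB (hcomp_hom dM mu (hcomp_in dM nu y)).
  by case: eqP => [->|/eqP ne]; rewrite ?subrr // subr0 Wy // inE negb_or ne.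
Qed.

Lemma boxed_chain_le (H : zvec r -> nat) s l : (forall nu, len (@aact A B M) [set 0] (gM nu) (H nu)) ->
  has_chain (between (@aact A B M) [set 0] (boxed s)) l ->
  (l <= \sum_(nu <- box r s) H nu)%N.
Proof.
move=> /(len_components (box_uniq r s)) [_ bd] c; apply: bd.
apply: has_chain_sub c => X [sX X0 Xs]; split=> //.
apply: subset_trans Xs _ => m bm nu nbox; apply: bm => inb.
by move: nbox; rewrite in_boxP.
Qed.

(** Otherwise each generator is killed by some element outside [p], and the product of these
    elements kills [M] while staying outside [p]. The generator found lets [B / p] be seen as a
    quotient of [B g]. *)
Lemma annihilator_prime gs p : is_prime_ideal p -> gspan gs = setT ->
  annihilator M `<=` p -> exists2 g, g \in gs & forall b, b *: g.2 = 0 -> p b.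
Proof.
move=> [_ p1 pM] gsT annp; apply: contrapT => nex.
suff [b npb kill] : exists2 b, ~ p b & forall m, gspan gs m -> b *: m = 0.
  by apply: npb; apply: annp => m; apply: kill; rewrite gsT.
have {}nex g : g \in gs -> exists2 b, ~ p b & b *: g.2 = 0.
  move=> ggs; apply: contrapT => h; apply: nex; exists g => // b bg.
  by apply: contrapT => npb; apply: h; exists b.
elim: gs nex {gsT} => [_|g gs IH nex] /=; first by exists 1 => // _ ->; rewrite scaler0.
have [b npb kill] := IH (fun g' h => nex g' (mem_behead (s := g :: gs) h)).
have [c npc cg] := nex g (mem_head _ _).
exists (b * c); first by move=> /pM[].
move=> _ [m [_ [Gm [e _ <-] ->]]].
rewrite scalerDr mulrC -scalerA kill // scaler0 add0r.
by rewrite scalerA -mulrA mulrC -scalerA cg scaler0.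
Qed.

Lemma boxed_scale s t (b : B) (m : M) :
  (forall nu, ~ in_box s nu -> hcomp dB nu b = 0) ->
  boxed t m -> boxed (s + t)%N (b *: m).
Proof.
move=> bb bm nu nbox; have [u [_ _ bE]] := hcomp_sum dB b.
rewrite bE scaler_suml hcomp_bigsum big1 // => mu _.
rewrite (hcomp_scale_hom gradedM nu m (hcomp_in dB mu b)).
have [bmu|nbmu] := pselect (in_box s mu); last by rewrite bb // scale0r.
rewrite bm ?scaler0 // => bnu; apply: nbox.
by rewrite -(subrK mu nu) addrC; exact: in_boxD.
Qed.

End GradedModuleHilbert.

(** * Existence of a pole of order at least the dimension *)

Section DimensionBound.
Variables (r : nat) (A : comNzRingType) (B : comAlgType A) (gB : nvec r -> set B).
Hypothesis gradedB : graded_algebra gB.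
Variables (M : lmodType B) (gM : zvec r -> set M).
Hypothesis gradedM : graded_module gB gM.
Local Notation gradedZ := (zgrading_graded gradedB).
Local Notation dB := (graded_direct gradedZ).
Local Notation dM := (graded_direct gradedM).
Local Notation primes_over I := [set p : set B | is_prime_ideal p /\ I `<=` p].

(** Members of the chain contain [p], hence the annihilator of [g], so strictness survives
    [X |-> (X meet boxed s) g] although [b |-> b *: g] need not be injective. *)
Lemma chain_to_module (p : set B) (g : M) s t l :
  submodule *%R p -> (forall b, b *: g = 0 -> p b) -> boxed gradedM t g ->
  has_chain (between (@aact A B B^o) p (msum p (boxed gradedZ s))) l ->
  has_chain (between (@aact A B M) [set 0] (boxed gradedM (s + t)%N)) l.
Proof.
move=> sp annp bg; have sF := submodule_boxed gradedB gradedZ s.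
apply: (@has_chain_map _ _ _ _ (fun X => [set b *: g | b in X `&` boxed gradedZ s])).
- move=> X [sX pX XF]; split.
  + split.
    * exists 0; last by rewrite scale0r.
      by split; [exact: submodule0 sX | exact: submodule0 sF].
    * move=> _ _ [b [Xb Fb] <-] [c [Xc Fc] <-]; exists (b - c); last by rewrite scalerBl.
      by split; [exact: (submoduleB sX) | exact: (submoduleB sF)].
    * move=> a _ [b [Xb Fb] <-]; exists (a%:A * b); last by rewrite /aact scalerA.
      by split; [exact: (submodule_act a sX) | exact: (submodule_act a sF)].
  + move=> _ ->; exists 0; last by rewrite scale0r.
    by split; [exact: submodule0 sX | exact: submodule0 sF].
  + by move=> _ [b [Xb Fb] <-]; exact: (boxed_scale Fb bg).
- by move=> X Y _ _ XY _ [b [Xb Fb] <-]; exists b => //; split=> //; exact: XY.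
- move=> X Y [sX pX XF] [sY pY YF] XY sub b Yb.
  have [k [c [pk Fc bE]]] := YF b Yb.
  have Yc : Y c.
    have -> : c = b - k by rewrite bE addrC addKr.
    by apply: (submoduleB sY) => //; exact: pY.
  have [|c' [Xc' Fc'] e] := sub (c *: g); first by exists c.
  rewrite bE; apply: (submoduleD sX); first exact: pX.
  rewrite -(subrK c' c); apply: (submoduleD sX) => //; apply/pX/annp.
  by rewrite scalerBl e subrr.
Qed.

Lemma exists_large_pole (L : seq (zvec r * nvec r))
    (gs : seq (zvec r * M)) d :
  gspan gs = setT ->
  (forall nu, len (@aact A B M) [set 0] (gM nu) (list_coef L nu)) ->
  has_chain (primes_over (annihilator M)) d ->
  exists2 p, p \in L & (d <= absdeg p.2)%N.
Proof.
move=> gsT lL [C [PC CC]]; apply: contrapT => nex.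
have Ld p : p \in L -> (absdeg p.2 < d)%N.
  by move=> pL; rewrite ltnNge; apply/negP => h; apply: nex; exists p.
have [N NP] := sum_box_list_coef Ld.
have [p0 annp] := PC 0%N isT.
have [g ggs gann] := annihilator_prime p0 gsT annp.
have [c0 bg] := boxed_cover gradedM g.2.
have [||||||||c cP] := @prime_chain_growth A B (@aact A B B^o) _ _ (boxed gradedZ) _ _ _ _ C d.
- exact: (aactD (M := B^o)).
- by move=> s x y; rewrite /aact /GRing.scale /= mulrCA.
- exact: submodule_boxed.
- by move=> s t st; exact: (boxed_mono (gradedM := gradedZ) st).
- by move=> s t y z; exact: (boxed_scale (gradedM := gradedZ)).
- exact: (boxed_cover gradedZ).
- by move=> i /PC[].
- exact: CC.
(* The box size [s] is linear in [u]: [c * u + c0] holds the chain of length [u ^ d], and the extra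
   [u] ensures [u < (s + N).+1]. The choice of [E] gives [(s + N).+1 <= E * u]. The two bounds then
   force [u.+1 <= size L * E ^ d], and [u] is chosen to violate this. *)
pose E := (c + c0 + N).+2; pose u := (size L * E ^ d).+1; pose s := (c * u + c0 + u)%N.
have sp0 : submodule *%R (C 0%N) by case: p0 => /is_idealP.
have cM : has_chain (between (@aact A B M) [set 0] (boxed gradedM s)) (u ^ d).
  apply: has_chain_sub (chain_to_module sp0 gann bg (cP u isT)) => X [sX X0 XF].
  by split=> //; apply: subset_trans XF _; apply: boxed_mono; exact: leq_addr.
have le1 := boxed_chain_le gradedB lL cM.
have le2 := NP s; have u0 : (0 < u)%N by [].
have XE : ((s + N).+1 <= E * u)%N by rewrite /s /E; nia.
have le3 : (u ^ d * u.+1 <= u ^ d * (size L * E ^ d))%N.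
  rewrite mulnCA -expnMn [(u * E)%N]mulnC.
  apply: (@leq_trans (size L * (s + N).+1 ^ d)).
    apply: leq_trans le2; apply: leq_mul => //; rewrite /s; lia.
  by rewrite leq_mul2l; apply/orP; right; case: (d) => // d'; rewrite leq_exp2r.
by move: le3; rewrite leq_pmul2l ?expn_gt0 // /u; lia.
Qed.

End DimensionBound.

(** * Laurent polynomials *)

Section Laurent.
Variable r : nat.
Implicit Types (P Q : laurent r) (F : zvec r -> int) (n : nvec r) (a nu : zvec r).

(** The linear functional sending [t^a] to [F a]. Coefficients, values at 1 and products with a
    series all have this form, so [pairing_mul] and additivity do the work of the ring laws. *)
Definition pairing F Q : int := mmap idfun F Q.

Lemma pairing_sum F (I : Type) (s : seq I) (p : pred I) (Q : I -> laurent r) :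
  pairing F (\sum_(i <- s | p i) Q i) = \sum_(i <- s | p i) pairing F (Q i).
Proof. exact: raddf_sum. Qed.

Lemma pairingU F c a : pairing F << c *g a >> = c * F a.
Proof. exact: mmapU. Qed.

Lemma pairing_mul F P Q :
  pairing F (laurent_mul P Q) = pairing (fun a => pairing (fun b => F (a + b)) Q) P.
Proof.
rewrite /laurent_mul pairing_sum; apply: eq_bigr => a _.
rewrite pairing_sum mulr_sumr; apply: eq_bigr => b _.
by rewrite pairingU mulrA.
Qed.

Lemma pairing_one_minus_t F i :
  pairing F (one_minus_t i) = F 0 - F (zvec_of (nunit i)).
Proof. by rewrite /pairing /one_minus_t raddfB /= !mmapU !mul1r. Qed.

Lemma mcoeff_pairing Q a : Q@_a = pairing (fun b => (b == a)%:R) Q.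
Proof.
rewrite [in LHS](monalgE Q) raddf_sum; apply: eq_bigr => b _ /=.
by rewrite mcoeffU mulr_natr.
Qed.

Lemma eval_at_1_pairing Q : eval_at_1 Q = pairing (fun=> 1) Q.
Proof. by apply: eq_bigr => a _; rewrite mulr1. Qed.

Lemma series_mul_pairing Q F nu : series_mul Q F nu = pairing (fun a => F (nu - a)) Q.
Proof. by []. Qed.

Lemma laurent_mul_sumr P (I : Type) (s : seq I) (p : pred I) (Q : I -> laurent r) :
  laurent_mul P (\sum_(i <- s | p i) Q i) = \sum_(i <- s | p i) laurent_mul P (Q i).
Proof.
apply/malgP => a; rewrite !mcoeff_pairing pairing_mul pairing_sum.
under [RHS]eq_bigr do rewrite pairing_mul.
rewrite exchange_big /=; apply: eq_bigr => b _.
by rewrite pairing_sum mulr_sumr.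
Qed.

Lemma series_mul_one_minus_t Q n i nu :
  series_mul (laurent_mul (one_minus_t i) Q) (inv_denom (n + nunit i)) nu =
  series_mul Q (inv_denom n) nu.
Proof.
rewrite !series_mul_pairing pairing_mul pairing_one_minus_t /pairing /mmap -sumrB.
apply: eq_bigr => a _; rewrite -mulrBr add0r; congr (_ * _).
rewrite !inv_denomE denom_coefS PoszD opprD [- _ - a]addrC !addrA.
by rewrite [X in X - _]addrC addrK.
Qed.

(** This is [(1 - t_i)^k t^a]. *)
Fixpoint padded_monomial (i : 'I_r) k a : laurent r :=
  if k is k'.+1 then laurent_mul (one_minus_t i) (padded_monomial i k' a) else << a >>.

Lemma series_mul_padded i k a n nu :
  series_mul (padded_monomial i k a) (inv_denom (n + nunit i *+ k)) nu =
  inv_denom n (nu - a).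
Proof.
elim: k => [|k IH] /=; first by rewrite addr0 series_mul_pairing pairingU mul1r.
by rewrite mulrSr addrA series_mul_one_minus_t.
Qed.

Lemma eval_at_1_padded i k a : eval_at_1 (padded_monomial i k a) = (k == 0%N)%:R.
Proof.
rewrite eval_at_1_pairing; case: k => [|k] /=; first by rewrite pairingU mulr1.
by rewrite pairing_mul pairing_one_minus_t subrr.
Qed.

Lemma absdeg_raise n i k : absdeg (n + nunit i *+ k) = (absdeg n + k)%N.
Proof.
elim: k => [|k IH]; first by rewrite addr0 addn0.
by rewrite mulrSr addrA absdegD IH absdeg_nunit addn1 addnS.
Qed.

(* Each term [t^a / (1-t)^n] with [|n| < d] is rewritten over the denominator
   [(1-t)^n (1-t_i)^(d-|n|)]; its numerator is then divisible by [1-t_i]. *)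
Lemma pole_decomposition (i : 'I_r) (L : seq (zvec r * nvec r)) d :
  (forall p, p \in L -> (absdeg p.2 <= d)%N) ->
  (exists2 p, p \in L & absdeg p.2 = d) ->
  exists Q : nvec r -> laurent r,
    [/\ forall n, absdeg n = d -> 0 <= eval_at_1 (Q n),
        forall nu : zvec r,
          (list_coef L nu)%:Z =
            \sum_(n \in [set n : nvec r | absdeg n = d])
               series_mul (Q n) (inv_denom n) nu,
        exists2 n, absdeg n = d & 0 < eval_at_1 (Q n)
      & forall n, absdeg n = d -> Q n <> 0 -> eval_at_1 (Q n) = 0 ->
          exists2 i : 'I_r, n i <> 0%N & laurent_dvd (one_minus_t i) (Q n)].
Proof.
move=> Ld [p0 p0L p0d].
pose gap (p : zvec r * nvec r) := (d - absdeg p.2)%N.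
pose top (p : zvec r * nvec r) : nvec r := p.2 + nunit i *+ gap p.
pose Q n := \sum_(p <- L | top p == n) padded_monomial i (gap p) p.1.
(* The value of [Q n] at 1 counts the terms of [L] with exponent exactly [n] that needed no
   padding. *)
have evalQ n : eval_at_1 (Q n) = \sum_(p <- L | top p == n) (gap p == 0%N)%:R.
  rewrite eval_at_1_pairing pairing_sum; apply: eq_bigr => p _.
  by rewrite -eval_at_1_pairing eval_at_1_padded.
have top0 p : gap p = 0%N -> top p = p.2 by move=> g0; rewrite /top g0 addr0.
exists Q; split.
- by move=> n _; rewrite evalQ; apply: sumr_ge0 => p _; apply: ler0n.
(* Only the finitely many [n] of the form [top p] carry a nonzero numerator. *)
- move=> nu; rewrite (fsbigE (undup (map top L))) ?undup_uniq //; last first.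
  + move=> n _; rewrite mem_undup => nL; rewrite /Q big1_seq; first by rewrite series_mul_pairing /pairing raddf0.
    by move=> p /andP[/eqP pn pL]; case/negP: nL; apply/mapP; exists p.
  + move=> n /=; rewrite mem_undup => /mapP[p pL ->].
    by rewrite absdeg_raise /gap subnKC // Ld.
  rewrite /list_coef (big_morph Posz PoszD (erefl _)).
  have seriesQ n : series_mul (Q n) (inv_denom n) nu =
      \sum_(p <- L | top p == n) (denom_coef p.2 (nu - p.1))%:Z.
    rewrite series_mul_pairing pairing_sum; apply: eq_bigr => p /eqP <-.
    by rewrite -series_mul_pairing series_mul_padded inv_denomE.
  rewrite [RHS](eq_bigr _ (fun n _ => seriesQ n)).
  rewrite (exchange_big_dep xpredT) //= big_seq [RHS]big_seq; apply: eq_bigr => p pL.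
  have pt : top p \in undup (map top L) by rewrite mem_undup map_f.
  have td : top p \in [set n : nvec r | absdeg n = d].
    by apply/mem_set; rewrite /= absdeg_raise /gap subnKC // Ld.
  by rewrite (big_rem _ pt) td eqxx /= big1_seq ?addr0 // => n /andP[/andP[_ /eqP <-]]; rewrite mem_rem_uniqF ?undup_uniq.
- have g0 : gap p0 = 0%N by rewrite /gap p0d subnn.
  exists p0.2 => //; rewrite evalQ (big_rem p0) //= top0 // g0 !eqxx.
  by rewrite ltr_wpDr // sumr_ge0 // => p _; apply: ler0n.
- move=> n nd Q0 ev0.
  (* A zero count means that every term of [Q n] was padded, so a factor [1 - t_i] comes out of
     each. *)
  have gap0 p : p \in L -> top p = n -> (0 < gap p)%N.
    move=> pL pn; rewrite lt0n; apply/eqP => g0; move: ev0.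
    rewrite evalQ (big_rem p) //= pn g0 !eqxx => e.
    have : 0 < 1 + \sum_(q <- rem p L | top q == n) (gap q == 0%N)%:R :> int.
      by rewrite ltr_wpDr // sumr_ge0 // => q _; apply: ler0n.
    by rewrite e ltxx.
  exists i.
    (* Since [Q n] is nonzero it has at least one term, and the padding of that term has made the
       [i]-th entry of [n] positive. *)
    have [p pL pn] : exists2 p, p \in L & top p = n.
      apply: contrapT => h; apply: Q0; rewrite /Q big1_seq // => p /andP[/eqP pn pL].
      by case: h; exists p.
    have := gap0 p pL pn; rewrite -pn /top; case: (gap p) => // k _.
    by rewrite mulrSr addrA add_nunitE eqxx addn1.
  exists (\sum_(p <- L | top p == n) padded_monomial i (gap p).-1 p.1).
  rewrite laurent_mul_sumr /Q big_seq_cond [RHS]big_seq_cond.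
  by apply: eq_bigr => p /andP[pL /eqP /(gap0 p pL)]; case: (gap p).
Qed.

End Laurent.

Unset Implicit Arguments.

Theorem theorem2p2 (r : nat) (r_gt0 : (0 < r)%N)
    (A : comNzRingType) (artA : artinian_ring A) (locA : local_ring A)
    (B : comAlgType A) (gB : nvec r -> set B)
    (gradedB : graded_algebra gB) (standardB : standard gB)
    (M : lmodType B) (gM : zvec r -> set M)
    (gradedM : graded_module gB gM) (fgM : fin_gen_module M)
    (d : nat) (dimM : krull_dim M d) :
  exists2 H : zvec r -> nat, hilbert_series gM H &
  exists Q : nvec r -> laurent r,
    [/\ forall n, absdeg n = d -> 0 <= eval_at_1 (Q n),
        forall nu : zvec r,
          (H nu)%:Z =
            \sum_(n \in [set n : nvec r | absdeg n = d])
               series_mul (Q n) (inv_denom n) nu,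
        exists2 n, absdeg n = d & 0 < eval_at_1 (Q n)
      & forall n, absdeg n = d -> Q n <> 0 -> eval_at_1 (Q n) = 0 ->
          exists2 i : 'I_r, n i <> 0%N & laurent_dvd (one_minus_t i) (Q n)].
Proof.
have [_ gB0 [k [x [degx genx]]]] := standardB.
have noeB : noetherian B.
  exact: noetherian_fin_gen_alg (artinian_noetherian artA) genx.
have [gs hgs gsT] := homogeneous_generators gradedM fgM.
have hl I : submodule *%R I -> homog (zgrading_graded gradedB) I ->
    exists L, hilbert_list gB I L.
  move=> sI; exact: (hilbert_list_ex noeB artA degx genx gB0 (I := exist _ I sI)).
have [L [lL cL]] := hilbert_list_gspan gradedM hl hgs.
have [chain_d max_d] := dimM.
have lM nu : len (@aact A B M) [set 0] (gM nu) (list_coef L nu).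
  by rewrite -[gM nu]setTI -gsT.
exists (list_coef L).
  move=> nu; have [c bd] := lM nu.
  have e : [set N | is_Asubmodule (A := A) N /\ N `<=` gM nu] =
           between (@aact A B M) [set 0] (gM nu).
    apply/seteqP; split=> N.
      move=> [/is_AsubmoduleP sN NgM]; split=> //.
      by move=> _ ->; exact: submodule0 sN.
    by move=> [sN _ NgM]; split=> //; apply/is_AsubmoduleP.
  by rewrite /length_A e.
have Ld p : p \in L -> (absdeg p.2 <= d)%N by move=> /cL /max_d.
apply: (pole_decomposition (Ordinal r_gt0) Ld).
have [p pL dp] := exists_large_pole gradedB gradedM gsT lM chain_d.
by exists p => //; apply/eqP; rewrite eqn_leq Ld.
Qed.
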